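(* Let $T=[n];(A_1,\dots,A_n)$ be a cell of $\Theta$ (with $\kappa_{A_k},\sigma_{A_k}$ already defined by recursion on height). With the three diagrams (columns) and the maps between them described in the context, the following hold. (1) The maps $P_j=P_j$ and $Q_k\xrightarrow{\mathrm{id};(\mathrm{id},\dots,\mathrm{pr}_2\circ\kappa_{A_k},\dots,\mathrm{id})}M_k$ are compatible with the middle and left columns, and the maps $P_j\xrightarrow{\mathsf{split}^{j+1}_{[n+1]};(!)}[1];([0])$ and $Q_k\xrightarrow{\mathsf{split}^k_{[n]};(\sigma_{A_k})}[1];([1];(A_k))$ are compatible with the middle and right columns. That is, for all $1\le k\le n$: (I) the composite $E_k^+\to Q_k\to M_k\to P_{k-1}$ equals $E_k^+\to P_{k-1}$; (II) the composite $E_k^-\to Q_k\to M_k\to P_k$ equals $E_k^-\to P_k$; (III) the composite $E_k^+\to P_{k-1}\to[1];([0])\to[1];([1];(A_k))$ equals $E_k^+\to Q_k\to[1];([1];(A_k))$; (IV) the composite $E_k^-\to P_k\to[1];([0])\to[1];([1];(A_k))$ equals $E_k^-\to Q_k\to[1];([1];(A_k))$. (2) The colimit of the left column is $[1]\times T$, the colimit of the middle column is $[1]\otimes T$, and the colimit of the right column is $[1];(T)$ (its globular sum decomposition). Hence the maps $P_j=P_j$ and $Q_k\xrightarrow{\mathrm{id};(\mathrm{id},\dots,\mathrm{pr}_2\circ\kappa_{A_k},\dots,\mathrm{id})}M_k$ from the middle to the left column induce a functor $\kappa_T$, and the maps $P_j\xrightarrow{\mathsf{split}^{j+1}_{[n+1]};(!)}[1];([0])$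 and $Q_k\xrightarrow{\mathsf{split}^k_{[n]};(\sigma_{A_k})}[1];([1];(A_k))$ from the middle to the right column induce a functor $\sigma_T$: $$[1]\times T\xleftarrow{\ \kappa_T\ }[1]\otimes T\xrightarrow{\ \sigma_T\ }[1];(T).$$ (3) For $\epsilon=0,1$ one has $\kappa_T\circ(\{\epsilon\}\otimes T)=\{\epsilon\}\times T$ and $\sigma_T\circ(\{\epsilon\}\otimes T)=\{\epsilon\}$, where $\{\epsilon\}:T\to[1];(T)$ is the constant functor at the object $\epsilon$.
   Context: All $\omega$-categories are strict; colimits are taken in the category $\omega\text{-}\mathsf{Cat}$ of strict $\omega$-categories. $[0]$ is the terminal $\omega$-category and $!$ denotes a map to it. **The construction $[n];(C_1,\dots,C_n)$.** For $\omega$-categories $C_1,\dots,C_n$, the $\omega$-category $[n];(C_1,\dots,C_n)$ has objects $0,\dots,n$, $\mathrm{Hom}(i,j)=\prod_{i<k\le j}C_k$ if $i\le j$ (terminal if $i=j$) and $\mathrm{Hom}(i,j)=\varnothing$ if $i>j$, with composition the canonical identifications of products. Write $[n]=[n];([0],\dots,[0])$. An order-preserving $f:[n]\to[m]$ and functors $g_{ji}:C_i\to D_j$ for $f(i-1)<j\le f(i)$ define a functor $f;(g):[n];(C_i)\to[m];(D_j)$ which is $f$ on objects and $(g_{ji})_j:C_i\to\prod_{f(i-1)<j\le f(i)}D_j$ on $\mathrm{Hom}(i-1,i)$. The cells of $\Theta$ are the $\omega$-categories obtained from $[0]$ by iterating: if $A_1,\dots,A_n$ ($n\ge0$) are cells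 then so is $[n];(A_1,\dots,A_n)$. $d^k:[n]\to[n+1]$ is the order-preserving injection omitting $k$. For $1\le j\le m$, $\mathsf{split}^j_{[m]}:[m]\to[1]$ sends $i<j$ to $0$ and $i\ge j$ to $1$; so for $g:C_j\to D$ there is a functor $\mathsf{split}^j_{[m]};(g):[m];(C_1,\dots,C_m)\to[1];(D)$. **The Gray cylinder (by the lax shuffle decomposition) and the middle column.** For a cell $T=[n];(A_1,\dots,A_n)$ define recursively $[1]\otimes T$ and functors $\{0\}\otimes T,\{1\}\otimes T:T\to[1]\otimes T$. Put $P_j=[n+1];(A_1,\dots,A_j,[0],A_{j+1},\dots,A_n)$ for $0\le j\le n$, $Q_k=[n];(A_1,\dots,A_{k-1},[1]\otimes A_k,A_{k+1},\dots,A_n)$ for $1\le k\le n$, and let $E_k^+,E_k^-$ ($1\le k\le n$) be copies of $T$. The middle column is the diagram $$P_0\leftarrow E_1^+\to Q_1\leftarrow E_1^-\to P_1\leftarrow E_2^+\to Q_2\leftarrow\cdots\to Q_n\leftarrow E_n^-\to P_n$$ with maps $E_k^+\to P_{k-1}$: $d^k;(\mathrm{id},\dots,(!,\mathrm{id}_{A_k}),\dots,\mathrm{id})$; $E_k^+\to Q_k$: $\mathrm{id};(\mathrm{id},\dots,\{0\}\otimes A_k,\dots,\mathrm{id})$; $E_k^-\to Q_k$: $\mathrm{id};(\mathrm{id},\dots,\{1\}\otimes A_k,\dots,\mathrm{id})$; $E_k^-\to P_k$: $d^k;(\mathrm{id},\dots,(\mathrm{id}_{A_k},!),\dots,\mathrm{id})$.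 $[1]\otimes T$ is by definition its colimit; $\{1\}\otimes T$ is $T\xrightarrow{d^0;(\mathrm{id},\dots)}P_0\to[1]\otimes T$ and $\{0\}\otimes T$ is $T\xrightarrow{d^{n+1};(\mathrm{id},\dots)}P_n\to[1]\otimes T$. In particular $[1]\otimes[0]=[1]$. **The left column.** With $M_k$ ($1\le k\le n$) copies of $T$, it is $$P_0\leftarrow M_1\to P_1\leftarrow M_2\to\cdots\leftarrow M_n\to P_n$$ with $M_k\to P_{k-1}$ equal to $d^k;(\mathrm{id},\dots,(!,\mathrm{id}_{A_k}),\dots,\mathrm{id})$ and $M_k\to P_k$ equal to $d^k;(\mathrm{id},\dots,(\mathrm{id}_{A_k},!),\dots,\mathrm{id})$. Its colimit cocone to $[1]\times T$ has $P_j\to[1]$ given by $\mathsf{split}^{j+1}_{[n+1]}$ and $P_j\to T$ the functor collapsing the inserted $[0]$-edge from $j$ to $j+1$. **The right column.** It is $$[1];([0])\to[1];([1];(A_1))\leftarrow[1];([0])\to[1];([1];(A_2))\leftarrow\cdots\to[1];([1];(A_n))\leftarrow[1];([0])$$ with $n+1$ copies of $[1];([0])$ indexed by $j=0,\dots,n$ (the $j$-th receiving the map from $P_j$); copy $k-1$ maps to $[1];([1];(A_k))$ by $\mathrm{id};(\{0\})$ and copy $k$ by $\mathrm{id};(\{1\})$, where $\{0\},\{1\}:[0]\to[1];(A_k)$ are the two objects. Its colimit cocone to $[1];(T)$ is $\mathrm{id};(\iota_k)$ on $[1];([1];(A_k))$, with $\iota_k:[1];(A_k)\to T$ the inclusion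 onto objects $k-1,k$, and $\mathrm{id};(\text{object }j)$ on the $j$-th copy of $[1];([0])$. **Recursion.** $\kappa_{[0]}:[1]\otimes[0]=[1]\to[1]\times[0]=[1]$ and $\sigma_{[0]}:[1]\otimes[0]=[1]\to[1];([0])=[1]$ are identities, and $\kappa_T,\sigma_T$ are defined as the induced maps of part (2). $\mathrm{pr}_2:[1]\times A\to A$ is the second projection, and $\{\epsilon\}\times T:T\to[1]\times T$ is the inclusion at $\epsilon$. *)

(* Defs.v *)
From mathcomp Require Import all_boot.
From mathcomp Require Import boolp zify.

Set Implicit Arguments.
Unset Strict Implicit.
Unset Printing Implicit Defensive.

(** * Strict omega-categories

    Single-sorted presentation (Street, Steiner): one type of cells, an
    m-cell being identified with the identities on it in higher dimensions,
    so that the m-cells are the [x] with [src m x = x].  Composition is in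
    diagrammatic order and [ocomp n x y] is meaningful only when
    [tgt n x = src n y]; outside of this case its value is junk, about which
    nothing is ever assumed. *)

Record ocat_laws (cell : Type) (src tgt : nat -> cell -> cell)
    (comp : nat -> cell -> cell -> cell) : Prop := OcatLaws {
  law_src_src_le : forall m n x, m <= n -> src n (src m x) = src m x;
  law_tgt_src_le : forall m n x, m <= n -> tgt n (src m x) = src m x;
  law_src_tgt_le : forall m n x, m <= n -> src n (tgt m x) = tgt m x;
  law_tgt_tgt_le : forall m n x, m <= n -> tgt n (tgt m x) = tgt m x;
  law_src_src_lt : forall m n x, m < n -> src m (src n x) = src m x;
  law_src_tgt_lt : forall m n x, m < n -> src m (tgt n x) = src m x;
  law_tgt_src_lt : forall m n x, m < n -> tgt m (src n x) = tgt m x;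
  law_tgt_tgt_lt : forall m n x, m < n -> tgt m (tgt n x) = tgt m x;
  law_src_comp : forall n x y, tgt n x = src n y -> src n (comp n x y) = src n x;
  law_tgt_comp : forall n x y, tgt n x = src n y -> tgt n (comp n x y) = tgt n y;
  law_src_comp_lt : forall m n x y, m < n -> tgt m x = src m y ->
    src n (comp m x y) = comp m (src n x) (src n y);
  law_tgt_comp_lt : forall m n x y, m < n -> tgt m x = src m y ->
    tgt n (comp m x y) = comp m (tgt n x) (tgt n y);
  law_comp_srcl : forall n x, comp n (src n x) x = x;
  law_comp_tgtr : forall n x, comp n x (tgt n x) = x;
  law_compA : forall n x y z, tgt n x = src n y -> tgt n y = src n z ->
    comp n x (comp n y z) = comp n (comp n x y) z;
  law_comp_interchange : forall m n x y z w, m < n ->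
    tgt n x = src n y -> tgt n z = src n w -> tgt m x = src m z ->
    comp m (comp n x y) (comp n z w) = comp n (comp m x z) (comp m y w);
  law_cell_findim : forall x, exists n, src n x = x
}.

Record ocat := Ocat {
  cell :> Type;
  src : nat -> cell -> cell;
  tgt : nat -> cell -> cell;
  ocomp : nat -> cell -> cell -> cell;
  ocatP : ocat_laws src tgt ocomp
}.

Definition src_src_le C := law_src_src_le (ocatP C).
Definition tgt_src_le C := law_tgt_src_le (ocatP C).
Definition src_tgt_le C := law_src_tgt_le (ocatP C).
Definition tgt_tgt_le C := law_tgt_tgt_le (ocatP C).
Definition src_src_lt C := law_src_src_lt (ocatP C).
Definition src_tgt_lt C := law_src_tgt_lt (ocatP C).
Definition tgt_src_lt C := law_tgt_src_lt (ocatP C).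
Definition tgt_tgt_lt C := law_tgt_tgt_lt (ocatP C).
Definition src_comp C := law_src_comp (ocatP C).
Definition tgt_comp C := law_tgt_comp (ocatP C).
Definition src_comp_lt C := law_src_comp_lt (ocatP C).
Definition tgt_comp_lt C := law_tgt_comp_lt (ocatP C).
Definition comp_srcl C := law_comp_srcl (ocatP C).
Definition comp_tgtr C := law_comp_tgtr (ocatP C).
Definition compA C := law_compA (ocatP C).
Definition comp_interchange C := law_comp_interchange (ocatP C).
Definition cell_findim C := law_cell_findim (ocatP C).

Record functor_laws (C D : ocat) (f : C -> D) : Prop := FunctorLaws {
  law_fmap_src : forall n x, f (src n x) = src n (f x);
  law_fmap_tgt : forall n x, f (tgt n x) = tgt n (f x);
  law_fmap_comp : forall n x y, tgt n x = src n y ->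
    f (ocomp n x y) = ocomp n (f x) (f y)
}.

Record functor (C D : ocat) := Functor {
  fmap :> C -> D;
  functorP : functor_laws fmap
}.

Definition fmap_src C D F := law_fmap_src (@functorP C D F).
Definition fmap_tgt C D F := law_fmap_tgt (@functorP C D F).
Definition fmap_comp C D F := law_fmap_comp (@functorP C D F).

Lemma functor_ext (C D : ocat) (F G : functor C D) : F =1 G -> F = G.
Proof.
case: F G => [f fP] [g gP] /= /funext fg; case: g / fg gP => gP.
by congr Functor; apply: Prop_irrelevance.
Qed.

Definition idF (C : ocat) : functor C C.
Proof. by exists id; split. Defined.

Lemma compF_laws (C D E : ocat) (G : functor D E) (F : functor C D) :
  functor_laws (fun x => G (F x)).
Proof.
split=> [n x|n x|n x y xy]; rewrite ?fmap_src ?fmap_tgt //.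
by rewrite fmap_comp // fmap_comp // -fmap_tgt -fmap_src xy.
Qed.

Definition compF (C D E : ocat) (G : functor D E) (F : functor C D) :
  functor C E := Functor (compF_laws G F).

Notation "G \oF F" := (compF G F) (at level 50, left associativity).

Definition castF (C D : ocat) (e : C = D) : functor C D :=
  match e with erefl => idF C end.

Lemma pt_laws :
  ocat_laws (fun _ => @id unit) (fun _ => @id unit) (fun _ x _ => x).
Proof. by split=> //; exists 0. Qed.

Definition pt : ocat := Ocat pt_laws.

Definition bang (C : ocat) : functor C pt.
Proof. by exists (fun=> tt); split. Defined.

Lemma oprod_laws (C D : ocat) :
  ocat_laws (fun n (x : C * D) => (src n x.1, src n x.2))
    (fun n x => (tgt n x.1, tgt n x.2))
    (fun n x y => (ocomp n x.1 y.1, ocomp n x.2 y.2)).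
Proof.
split.
- by move=> m n [x y] mn /=; rewrite !src_src_le.
- by move=> m n [x y] mn /=; rewrite !tgt_src_le.
- by move=> m n [x y] mn /=; rewrite !src_tgt_le.
- by move=> m n [x y] mn /=; rewrite !tgt_tgt_le.
- by move=> m n [x y] mn /=; rewrite !src_src_lt.
- by move=> m n [x y] mn /=; rewrite !src_tgt_lt.
- by move=> m n [x y] mn /=; rewrite !tgt_src_lt.
- by move=> m n [x y] mn /=; rewrite !tgt_tgt_lt.
- by move=> n [x y] [z w] /= [? ?]; rewrite !src_comp.
- by move=> n [x y] [z w] /= [? ?]; rewrite !tgt_comp.
- by move=> m n [x y] [z w] /= mn [? ?]; rewrite !src_comp_lt.
- by move=> m n [x y] [z w] /= mn [? ?]; rewrite !tgt_comp_lt.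
- by move=> n [x y] /=; rewrite !comp_srcl.
- by move=> n [x y] /=; rewrite !comp_tgtr.
- by move=> n [x x'] [y y'] [z z'] /= [? ?] [? ?]; rewrite !compA.
- move=> m n [x x'] [y y'] [z z'] [w w'] /= mn [? ?] [? ?] [? ?].
  by rewrite !(comp_interchange mn).
- move=> [x y]; have [a xa] := cell_findim x; have [b yb] := cell_findim y.
  exists (maxn a b) => /=; rewrite -{1}xa -{1}yb.
  by rewrite !src_src_le ?leq_maxl ?leq_maxr // xa yb.
Qed.

Definition oprod (C D : ocat) : ocat := Ocat (oprod_laws C D).

Lemma pairF_laws (X C D : ocat) (F : functor X C) (G : functor X D) :
  functor_laws (fun x => (F x, G x) : oprod C D).
Proof.
split=> [n x|n x|n x y xy].
- by rewrite !fmap_src.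
- by rewrite !fmap_tgt.
- by rewrite !fmap_comp.
Qed.

Definition pairF (X C D : ocat) (F : functor X C) (G : functor X D) :
  functor X (oprod C D) := Functor (pairF_laws F G).

Definition pr2 (C D : ocat) : functor (oprod C D) D.
Proof. by exists (@snd C D); split. Defined.

(** * The construction [n];(C_1,...,C_n)

    Edges are numbered from 0: [C k] sits on the edge from object [k] to
    object [k.+1], i.e. it is C_(k+1) of the usual notation.  A cell of
    Hom(i,j) is an element of the product of the [C k], i <= k < j; it is
    stored as a family of options, defined exactly at these [k].  The object
    [i] is the unique cell of Hom(i,i). *)

Section Bracket.
Variables (n : nat) (C : 'I_n -> ocat).

Record bcell := BCell {
  bdom : 'I_n.+1;
  bcod : 'I_n.+1;
  bval : forall k, option (C k);
  bdom_le : (bdom <= bcod)%N;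
  bvalP : forall k, isSome (bval k) = (bdom <= k < bcod)%N
}.

Lemma bcell_eq (x y : bcell) : bdom x = bdom y -> bcod x = bcod y ->
  (forall k, bval x k = bval y k) -> x = y.
Proof.
case: x y => [i j v l p] [i' j' v' l' p'] /= ei ej ev; subst i' j'.
have {}ev : v = v' by apply: functional_extensionality_dep.
by subst v'; congr BCell; apply: Prop_irrelevance.
Qed.

Lemma bobjP (i : 'I_n.+1) (k : 'I_n) :
  isSome (None : option (C k)) = (i <= k < i)%N.
Proof. by rewrite leqNgt andNb. Qed.

Definition bobj (i : 'I_n.+1) : bcell := BCell (leqnn i) (bobjP i).

Lemma bpointwiseP (h : forall k, C k -> C k) (x : bcell) k :
  isSome (omap (h k) (bval x k)) = (bdom x <= k < bcod x)%N.
Proof. by rewrite -bvalP; case: bval. Qed.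

Definition bpointwise (h : forall k, C k -> C k) (x : bcell) : bcell :=
  BCell (bdom_le x) (bpointwiseP h x).

Definition bsrc m (x : bcell) : bcell :=
  if m is m'.+1 then bpointwise (fun k => src m') x else bobj (bdom x).

Definition btgt m (x : bcell) : bcell :=
  if m is m'.+1 then bpointwise (fun k => tgt m') x else bobj (bcod x).

Lemma bconcat_le (x y : bcell) : bcod x = bdom y -> (bdom x <= bcod y)%N.
Proof. by move=> xy; rewrite (leq_trans (bdom_le x)) // xy bdom_le. Qed.

Lemma bconcat_valP (x y : bcell) : bcod x = bdom y -> forall k,
  isSome (if bval x k is Some a then Some a else bval y k) =
  (bdom x <= k < bcod y)%N.
Proof.
move=> xy k; have := bvalP x k; have := bvalP y k; rewrite -xy.
have := bdom_le x; have := bdom_le y; rewrite -xy.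
case: (bval x k) => [a|] /=; first by move=> *; lia.
by case: (bval y k) => [a|] /=; move=> *; lia.
Qed.

Definition bconcat (x y : bcell) (xy : bcod x = bdom y) : bcell :=
  BCell (bconcat_le xy) (bconcat_valP xy).

Definition bcomp_val m (x y : bcell) (k : 'I_n) : option (C k) :=
  match bval x k, bval y k with
  | Some a, Some b => Some (ocomp m a b)
  | o, _ => o
  end.

Lemma bcomp_valP m (x y : bcell) k :
  isSome (bcomp_val m x y k) = (bdom x <= k < bcod x)%N.
Proof.
by rewrite -bvalP /bcomp_val; case: (bval x k) => //= a; case: (bval y k).
Qed.

Definition bcomp (m : nat) (x y : bcell) : bcell :=
  match m with
  | 0 => if bcod x =P bdom y is ReflectT xy then bconcat xy else x
  | m'.+1 => BCell (bdom_le x) (bcomp_valP m' x y)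
  end.

Lemma bcomp0E (x y : bcell) : bcod x = bdom y ->
  [/\ bdom (bcomp 0 x y) = bdom x, bcod (bcomp 0 x y) = bcod y &
      forall k, bval (bcomp 0 x y) k =
        if bval x k is Some a then Some a else bval y k].
Proof. by move=> xy; rewrite /bcomp; case: eqP. Qed.

Lemma bracket_findim (x : bcell) : exists m, bsrc m x = x.
Proof.
have /fin_all_exists [d dP] k : exists m, omap (src m) (bval x k) = bval x k.
  case: (bval x k) => [a|]; last by exists 0.
  by have [m am] := cell_findim a; exists m; rewrite /= am.
exists (\max_k d k).+1; apply: bcell_eq => //= k.
rewrite -{1}dP; case E: (bval x k) (dP k) => [a|] //= [ak].
by rewrite src_src_le ?ak //; apply: leq_bigmax.
Qed.

Lemma bracket_laws : ocat_laws bsrc btgt bcomp.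
Proof.
split.
- move=> [|m] [|p] x mp //; apply: bcell_eq => //= k.
  by case: (bval x k) => //= a; rewrite src_src_le.
- move=> [|m] [|p] x mp //; apply: bcell_eq => //= k.
  by case: (bval x k) => //= a; rewrite tgt_src_le.
- move=> [|m] [|p] x mp //; apply: bcell_eq => //= k.
  by case: (bval x k) => //= a; rewrite src_tgt_le.
- move=> [|m] [|p] x mp //; apply: bcell_eq => //= k.
  by case: (bval x k) => //= a; rewrite tgt_tgt_le.
- move=> [|m] [|p] x mp //; apply: bcell_eq => //= k.
  by case: (bval x k) => //= a; rewrite src_src_lt.
- move=> [|m] [|p] x mp //; apply: bcell_eq => //= k.
  by case: (bval x k) => //= a; rewrite src_tgt_lt.
- move=> [|m] [|p] x mp //; apply: bcell_eq => //= k.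
  by case: (bval x k) => //= a; rewrite tgt_src_lt.
- move=> [|m] [|p] x mp //; apply: bcell_eq => //= k.
  by case: (bval x k) => //= a; rewrite tgt_tgt_lt.
- move=> [|m] x y xy.
    have /bcomp0E[ed ec ev] : bcod x = bdom y by case: xy.
    by apply: bcell_eq; rewrite //= ed.
  have eq k : omap (tgt m) (bval x k) = omap (src m) (bval y k).
    by rewrite -[LHS]/(bval (btgt m.+1 x) k) xy.
  apply: bcell_eq => //= k; rewrite /bcomp_val /=; move: (eq k).
  by case: (bval x k) => [a|]; case: (bval y k) => [b|] //= [ab]; rewrite src_comp.
- move=> [|m] x y xy.
    have /bcomp0E[ed ec ev] : bcod x = bdom y by case: xy.
    by apply: bcell_eq; rewrite //= ec.
  have eq k : omap (tgt m) (bval x k) = omap (src m) (bval y k).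
    by rewrite -[LHS]/(bval (btgt m.+1 x) k) xy.
  have ed : bdom x = bdom y by have := congr1 bdom xy.
  have ec : bcod x = bcod y by have := congr1 bcod xy.
  apply: bcell_eq => //= k; rewrite /bcomp_val /=; move: (eq k).
  by case: (bval x k) => [a|]; case: (bval y k) => [b|] //= [ab]; rewrite tgt_comp.
- move=> [|m] [|p] x y // mp xy.
    have xy' : bcod x = bdom y by case: xy.
    have [ed ec ev] := bcomp0E xy'.
    have xy2 : bcod (bsrc p.+1 x) = bdom (bsrc p.+1 y) by [].
    have [ed2 ec2 ev2] := bcomp0E xy2.
    apply: bcell_eq; rewrite ?ed2 ?ec2 //= => k; rewrite ev ev2 /=.
    by case: (bval x k).
  have eq k : omap (tgt m) (bval x k) = omap (src m) (bval y k).
    by rewrite -[LHS]/(bval (btgt m.+1 x) k) xy.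
  apply: bcell_eq => //= k; rewrite /bcomp_val /=; move: (eq k).
  by case: (bval x k) => [a|]; case: (bval y k) => [b|] //= [ab]; rewrite src_comp_lt.
- move=> [|m] [|p] x y // mp xy.
    have xy' : bcod x = bdom y by case: xy.
    have [ed ec ev] := bcomp0E xy'.
    have xy2 : bcod (btgt p.+1 x) = bdom (btgt p.+1 y) by [].
    have [ed2 ec2 ev2] := bcomp0E xy2.
    apply: bcell_eq; rewrite ?ed2 ?ec2 //= => k; rewrite ev ev2 /=.
    by case: (bval x k).
  have eq k : omap (tgt m) (bval x k) = omap (src m) (bval y k).
    by rewrite -[LHS]/(bval (btgt m.+1 x) k) xy.
  apply: bcell_eq => //= k; rewrite /bcomp_val /=; move: (eq k).
  by case: (bval x k) => [a|]; case: (bval y k) => [b|] //= [ab]; rewrite tgt_comp_lt.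
- move=> [|m] x.
    have xy : bcod (bsrc 0 x) = bdom x by [].
    by have [ed ec ev] := bcomp0E xy; apply: bcell_eq => // k; rewrite ev.
  by apply: bcell_eq => //= k; rewrite /bcomp_val /=; case: (bval x k) => //= a; rewrite comp_srcl.
- move=> [|m] x.
    have xy : bcod x = bdom (btgt 0 x) by [].
    have [ed ec ev] := bcomp0E xy; apply: bcell_eq => // k; rewrite ev.
    by case: (bval x k).
  by apply: bcell_eq => //= k; rewrite /bcomp_val /=; case: (bval x k) => //= a; rewrite comp_tgtr.
- move=> [|m] x y z xy yz.
    have xy' : bcod x = bdom y by case: xy.
    have yz' : bcod y = bdom z by case: yz.
    have [ed1 ec1 ev1] := bcomp0E xy'; have [ed2 ec2 ev2] := bcomp0E yz'.
    have x_yz : bcod x = bdom (bcomp 0 y z) by rewrite ed2.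
    have xy_z : bcod (bcomp 0 x y) = bdom z by rewrite ec1.
    have [ed3 ec3 ev3] := bcomp0E x_yz; have [ed4 ec4 ev4] := bcomp0E xy_z.
    apply: bcell_eq; rewrite ?ed3 ?ec3 ?ed4 ?ec4 // => k.
    by rewrite ev3 ev4 ev1 ev2; case: (bval x k).
  have exy k : omap (tgt m) (bval x k) = omap (src m) (bval y k).
    by rewrite -[LHS]/(bval (btgt m.+1 x) k) xy.
  have eyz k : omap (tgt m) (bval y k) = omap (src m) (bval z k).
    by rewrite -[LHS]/(bval (btgt m.+1 y) k) yz.
  apply: bcell_eq => //= k; rewrite /bcomp_val /=; move: (exy k) (eyz k).
  case: (bval x k) => [a|]; case: (bval y k) => [b|] //=.
  by case: (bval z k) => [c|] //= [ab] [bc]; rewrite compA.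
- move=> [|m] [|p] x y z w // mp xy zw xz.
    have xz' : bcod x = bdom z by case: xz.
    have edxy : bdom x = bdom y by have := congr1 bdom xy.
    have ecxy : bcod x = bcod y by have := congr1 bcod xy.
    have edzw : bdom z = bdom w by have := congr1 bdom zw.
    have yw' : bcod y = bdom w by rewrite -ecxy -edzw.
    have [ed1 ec1 ev1] := bcomp0E xz'; have [ed2 ec2 ev2] := bcomp0E yw'.
    have xyzw : bcod (bcomp p.+1 x y) = bdom (bcomp p.+1 z w) by [].
    have [ed3 ec3 ev3] := bcomp0E xyzw.
    apply: bcell_eq; rewrite ?ed3 ?ec3 //= => k.
    rewrite ev3 /= /bcomp_val ev1 ev2 /=.
    have hy : isSome (bval x k) = isSome (bval y k).
      by rewrite !bvalP edxy ecxy.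
    by case: (bval x k) hy => [a|] /=; case: (bval y k).
  have exy k : omap (tgt p) (bval x k) = omap (src p) (bval y k).
    by rewrite -[LHS]/(bval (btgt p.+1 x) k) xy.
  have ezw k : omap (tgt p) (bval z k) = omap (src p) (bval w k).
    by rewrite -[LHS]/(bval (btgt p.+1 z) k) zw.
  have exz k : omap (tgt m) (bval x k) = omap (src m) (bval z k).
    by rewrite -[LHS]/(bval (btgt m.+1 x) k) xz.
  apply: bcell_eq => //= k; rewrite /bcomp_val /=; move: (exy k) (ezw k) (exz k).
  case: (bval x k) => [a|]; case: (bval y k) => [b|] //=.
  case: (bval z k) => [c|] //=; case: (bval w k) => [d|] //= [ab] [cd] [ac].
  by rewrite (comp_interchange (m := m)).
- exact: bracket_findim.
Qed.

Definition bracket : ocat := Ocat bracket_laws.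

End Bracket.

Record delta (n m : nat) := Delta {
  dmap :> 'I_n.+1 -> 'I_m.+1;
  dmap_mono : forall i j : 'I_n.+1, (i <= j)%N -> (dmap i <= dmap j)%N
}.

(** [inspan f i l]: the edge [l] of [m] lies on the image under [f] of the
    edge [i] of [n]. *)
Definition inspan n m (f : delta n m) (i : 'I_n) (l : 'I_m) : bool :=
  (f (widen_ord (leqnSn n) i) <= l < f (lift ord0 i))%N.

Section Bmap.
Variables (n m : nat) (f : delta n m).
Variables (C : 'I_n -> ocat) (D : 'I_m -> ocat).

Lemma inspan_uniq i i' l : inspan f i l -> inspan f i' l -> i = i'.
Proof.
move=> /andP[h1 h2] /andP[h1' h2']; apply/val_inj/eqP; rewrite eqn_leq.
have aux (a b : 'I_n) : f (widen_ord (leqnSn n) a) <= l -> l < f (lift ord0 b) ->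
    a <= b.
  move=> ha hb; rewrite leqNgt; apply/negP => ba.
  have : f (lift ord0 b) <= f (widen_ord (leqnSn n) a).
    by apply: dmap_mono; rewrite /= /bump.
  by move=> /(leq_trans hb); rewrite ltnNge ha.
by rewrite !aux.
Qed.

Lemma inspan_exists (a b : 'I_n.+1) (l : 'I_m) : (f a <= l < f b)%N ->
  exists2 i : 'I_n, (a <= i < b)%N & inspan f i l.
Proof.
case/andP=> al lb.
pose i0 := [arg min_(o < b | (l < f o)%N) (o : nat)].
have [i li imin] : exists2 i : 'I_n.+1, (l < f i)%N &
    forall j : 'I_n.+1, (l < f j)%N -> (i <= j)%N.
  by exists i0; rewrite /i0; case: arg_minnP.
have ai : a < i.
  rewrite ltnNge; apply/negP => /(dmap_mono f) h.
  by have := leq_trans li h; rewrite ltnNge al.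
have i_gt0 : 0 < i by apply: leq_ltn_trans ai.
have in' : i.-1 < n by have := ltn_ord i; lia.
pose e := Ordinal in'.
have eS : lift ord0 e = i by apply: val_inj; rewrite /= /bump /=; lia.
exists e; first by have := imin _ lb; rewrite /=; lia.
rewrite /inspan eS li andbT leqNgt; apply/negP => /imin /=; lia.
Qed.

Lemma inspan_range (a b : 'I_n.+1) (i : 'I_n) (l : 'I_m) : inspan f i l ->
  (f a <= l < f b)%N = (a <= i < b)%N.
Proof.
move=> il; apply/idP/idP; first by case/inspan_exists => i' ab /inspan_uniq/(_ il) <-.
case/andP=> ai ib; case/andP: il => il li; apply/andP; split.
  by apply: leq_trans il; apply: dmap_mono.
by apply: leq_trans li _; apply: dmap_mono; rewrite /= /bump.
Qed.

Variable g : forall i l, inspan f i l -> functor (C i) (D l).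

(** The component at [l] of the image of a cell [v] is the image of the
    component of [v] at the unique edge whose span contains [l], if any. *)
Definition bmap_val (v : forall i, option (C i)) (l : 'I_m) : option (D l) :=
  if [pick u : {i | inspan f i l}] is Some u
  then omap (g (valP u)) (v (val u)) else None.

Lemma bmap_valE v i l (il : inspan f i l) : bmap_val v l = omap (g il) (v i).
Proof.
rewrite /bmap_val; case: pickP => [[i' i'l] _ /=|/(_ (exist _ i il)) //].
have ei := inspan_uniq il i'l; subst i'.
exact: (f_equal (fun h => omap (g h) (v i)) (bool_irrelevance _ _)).
Qed.

Lemma bmap_valN v l : (forall i, inspan f i l = false) -> bmap_val v l = None.
Proof.
by move=> h; rewrite /bmap_val; case: pickP => // -[i il]; have := h i; rewrite il.
Qed.

Lemma bmap_valP (x : bcell C) l :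
  isSome (bmap_val (bval x) l) = (f (bdom x) <= l < f (bcod x))%N.
Proof.
case: (pickP (fun i => inspan f i l)) => [i il|h].
  by rewrite (bmap_valE _ il) (inspan_range _ _ il) -bvalP; case: bval.
rewrite bmap_valN //; apply/esym/negbTE/negP => /inspan_exists[i _].
by rewrite h.
Qed.

Definition bmap_fun (x : bcell C) : bcell D :=
  BCell (dmap_mono f (bdom_le x)) (bmap_valP x).

Lemma bmap_laws :
  @functor_laws (bracket C) (bracket D) bmap_fun.
Proof.
split.
- move=> [|p] x; apply: bcell_eq => //= l.
    by case: (pickP (fun i => inspan f i l)) => [i il|h];
      rewrite ?(bmap_valE _ il) ?bmap_valN.
  case: (pickP (fun i => inspan f i l)) => [i il|h]; last by rewrite !bmap_valN.
  by rewrite !(bmap_valE _ il); case: bval => //= a; rewrite fmap_src.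
- move=> [|p] x; apply: bcell_eq => //= l.
    by case: (pickP (fun i => inspan f i l)) => [i il|h];
      rewrite ?(bmap_valE _ il) ?bmap_valN.
  case: (pickP (fun i => inspan f i l)) => [i il|h]; last by rewrite !bmap_valN.
  by rewrite !(bmap_valE _ il); case: bval => //= a; rewrite fmap_tgt.
- move=> [|p] x y xy.
    have xy' : bcod x = bdom y by case: xy.
    have [ed ec ev] := bcomp0E xy'.
    have fxy : bcod (bmap_fun x) = bdom (bmap_fun y) by rewrite /= xy'.
    have [ed2 ec2 ev2] := bcomp0E fxy.
    apply: bcell_eq; rewrite ?ed2 ?ec2 /= ?ed ?ec // => l; rewrite ev2 /=.
    case: (pickP (fun i => inspan f i l)) => [i il|h]; last by rewrite !bmap_valN.
    by rewrite !(bmap_valE _ il) ev; case: (bval x i).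
  have eq i : omap (tgt p) (bval x i) = omap (src p) (bval y i).
    by rewrite -[LHS]/(bval (btgt p.+1 x) i) [btgt _ _]xy.
  apply: bcell_eq => //= l; rewrite [RHS]/bcomp_val /=.
  case: (pickP (fun i => inspan f i l)) => [i il|h]; last by rewrite !bmap_valN.
  rewrite !(bmap_valE _ il) /bcomp_val /=; move: (eq i).
  case: (bval x i) => [a|]; case: (bval y i) => [b|] //= [ab].
  by rewrite fmap_comp.
Qed.

(** f;(g), where [g i l] is g_(l,i). *)
Definition bmap : functor (bracket C) (bracket D) := Functor bmap_laws.

End Bmap.

Lemma objF_laws n (C : 'I_n -> ocat) (i : 'I_n.+1) :
  @functor_laws pt (bracket C) (fun=> bobj C i).
Proof.
split.
- by move=> [|p] x //=; apply: bcell_eq.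
- by move=> [|p] x //=; apply: bcell_eq.
- move=> [|p] x y _; last by apply: bcell_eq.
  have ii : bcod (bobj C i) = bdom (bobj C i) by [].
  by have [ed ec ev] := bcomp0E ii; apply: bcell_eq; rewrite ?ed ?ec.
Qed.

Definition objF n (C : 'I_n -> ocat) (i : 'I_n.+1) : functor pt (bracket C) :=
  Functor (objF_laws C i).

(** Maps of the form id;(g_1,...,g_n). *)

Definition did n : delta n n := @Delta n n id (fun _ _ => id).

Lemma inspan_did n (i l : 'I_n) : inspan (did n) i l -> i = l.
Proof. by rewrite /inspan /= /bump => h; apply: val_inj => /=; lia. Qed.

Definition bmap_id n (C D : 'I_n -> ocat) (g : forall i, functor (C i) (D i)) :
  functor (bracket C) (bracket D) :=
  @bmap n n (did n) C D
    (fun i l il => castF (congr1 D (inspan_did il)) \oF g i).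

(** [1];(C), and [1] = [1];([0]). *)

Definition susp (C : ocat) : ocat := bracket (fun _ : 'I_1 => C).
Definition arrow : ocat := susp pt.

Definition suspF (C D : ocat) (g : functor C D) : functor (susp C) (susp D) :=
  bmap_id (fun _ : 'I_1 => g).

(** Endpoints are indexed by booleans: 0 is [false], 1 is [true]. *)
Definition endpt (e : bool) : 'I_2 := if e then ord_max else ord0.
Definition endF (C : ocat) (e : bool) : functor pt (susp C) :=
  objF (fun _ => C) (endpt e).

(** split^(j+1);(g), where g : C_(j+1) -> D. *)

Lemma dsplit_mono m (j : 'I_m) (o o' : 'I_m.+1) : (o <= o')%N ->
  (endpt (j < o) <= endpt (j < o'))%N.
Proof. by move=> oo'; case: ltnP => //= jo; rewrite (leq_trans jo oo'). Qed.

Definition dsplit m (j : 'I_m) : delta m 1 := Delta (@dsplit_mono m j).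

Lemma inspan_dsplit m (j i : 'I_m) (l : 'I_1) : inspan (dsplit j) i l -> i = j.
Proof.
rewrite /inspan /= /bump /= add1n => h; apply: val_inj => /=; move: h.
rewrite ord1.
by case: (ltnP j i) => /= ji; case: (ltnP j i.+1) => //= ji' _; lia.
Qed.

Definition splitF m (C : 'I_m -> ocat) (D : ocat) (j : 'I_m)
  (g : functor (C j) D) : functor (bracket C) (susp D) :=
  @bmap m 1 (dsplit j) C (fun _ => D)
    (fun i l il => g \oF castF (congr1 C (inspan_dsplit il))).

(** iota_(k+1) : [1];(A_(k+1)) -> [n];(A_1,...,A_n). *)

Lemma dedge_mono n (k : 'I_n) (o o' : 'I_2) : (o <= o')%N ->
  ((inord (k + o) : 'I_n.+1) <= (inord (k + o') : 'I_n.+1))%N.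
Proof.
by move=> oo'; rewrite !inordK ?leq_add2l //; have := ltn_ord o;
  have := ltn_ord o'; have := ltn_ord k; lia.
Qed.

Definition dedge n (k : 'I_n) : delta 1 n := Delta (@dedge_mono n k).

Lemma inspan_dedge n (k l : 'I_n) (i : 'I_1) : inspan (dedge k) i l -> k = l.
Proof.
rewrite /inspan /= ord1 /= /bump /= !inordK; try by have := ltn_ord k; lia.
by move=> h; apply: val_inj => /=; lia.
Qed.

Definition edgeF n (A : 'I_n -> ocat) (k : 'I_n) :
  functor (susp (A k)) (bracket A) :=
  @bmap 1 n (dedge k) (fun _ => A k) A
    (fun i l il => castF (congr1 A (inspan_dedge il))).

(** * Inserting [0]

    [insert j A] is the family (A_1,...,A_j,[0],A_(j+1),...,A_n). *)

Definition insert n (j : 'I_n.+1) (A : 'I_n -> ocat) (l : 'I_n.+1) : ocat :=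
  oapp A pt (unlift j l).

(** Identity components, with the map to the inserted [0] everywhere else. *)
Definition to_insert (I : Type) (A : I -> ocat) (i : I) (o : option I) :
  (forall k, o = Some k -> i = k) -> functor (A i) (oapp A pt o) :=
  match o with
  | Some k => fun h => castF (congr1 A (h k erefl))
  | None => fun _ => bang (A i)
  end.

Definition from_insert (I : Type) (A : I -> ocat) (i : I) (o : option I)
  (h : o = Some i) : functor (oapp A pt o) (A i) :=
  castF (congr1 (oapp A pt) h).

Lemma dface_mono n (p : 'I_n.+2) (i j : 'I_n.+1) : (i <= j)%N ->
  (lift p i <= lift p j)%N.
Proof. by rewrite /= leq_bump2. Qed.

Definition dface n (p : 'I_n.+2) : delta n n.+1 := Delta (@dface_mono n p).

Lemma inspan_dface n (p : 'I_n.+2) (j l : 'I_n.+1) (i k : 'I_n) :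
  (j <= p <= j.+1)%N -> inspan (dface p) i l -> unlift j l = Some k -> i = k.
Proof.
move=> jp; rewrite /inspan /= => h; case: unliftP => // k' el [<-].
move: h; rewrite el /= /bump; move=> h; apply: val_inj => /=; move: h jp.
by rewrite /=; lia.
Qed.

(** The maps d^p;(id,...,id) (inserted edge at an end of [n+1]),
    d^p;(id,...,(!,id),...,id) (p = j+1) and d^p;(id,...,(id,!),...,id)
    (p = j) from T to P_j: the two edges of [n+1] replacing the edge on which
    the object p is omitted are the inserted edge (j,j+1), carrying [0], and
    the edge carrying the corresponding A_k. *)
Definition faceF n (A : 'I_n -> ocat) (j : 'I_n.+1) (p : 'I_n.+2)
  (jp : (j <= p <= j.+1)%N) : functor (bracket A) (bracket (insert j A)) :=
  @bmap n n.+1 (dface p) A (insert j A)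
    (fun i l il => to_insert A (fun k => inspan_dface jp il)).

Lemma face_loP n (j : 'I_n.+1) : (j <= widen_ord (leqnSn _) j <= j.+1)%N.
Proof. by rewrite /=; lia. Qed.

Lemma face_hiP n (j : 'I_n.+1) : (j <= lift ord0 j <= j.+1)%N.
Proof. by rewrite /= /bump; lia. Qed.

Definition face_lo n (A : 'I_n -> ocat) (j : 'I_n.+1) :
  functor (bracket A) (bracket (insert j A)) := faceF A (face_loP j).

Definition face_hi n (A : 'I_n -> ocat) (j : 'I_n.+1) :
  functor (bracket A) (bracket (insert j A)) := faceF A (face_hiP j).

(** The functor P_j -> T collapsing the inserted edge. *)

Lemma ddegen_mono n (j : 'I_n.+1) (o o' : 'I_n.+2) : (o <= o')%N ->
  ((inord (unbump j o) : 'I_n.+1) <= (inord (unbump j o') : 'I_n.+1))%N.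
Proof.
have := ltn_ord j; have := ltn_ord o; have := ltn_ord o' => *.
by rewrite !inordK /unbump; lia.
Qed.

Definition ddegen n (j : 'I_n.+1) : delta n.+1 n := Delta (@ddegen_mono n j).

Lemma inspan_ddegen n (j l : 'I_n.+1) (i : 'I_n) :
  inspan (ddegen j) l i -> unlift j l = Some i.
Proof.
rewrite /inspan /=; have := ltn_ord j; have := ltn_ord l => hl hj.
rewrite !inordK /unbump /= /bump /=; try lia.
case: unliftP => [k ->|->]; rewrite /= /bump => h; last by lia.
by congr Some; apply: val_inj => /=; lia.
Qed.

Definition collapse n (A : 'I_n -> ocat) (j : 'I_n.+1) :
  functor (bracket (insert j A)) (bracket A) :=
  @bmap n.+1 n (ddegen j) (insert j A) A
    (fun l i li => from_insert A (inspan_ddegen li)).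

(** * Diagrams and colimits

    A diagram is indexed by the free category on a graph. *)

Record diagram := Diagram {
  vert : Type;
  edge : Type;
  esrc : edge -> vert;
  etgt : edge -> vert;
  dobj : vert -> ocat;
  dmor : forall e, functor (dobj (esrc e)) (dobj (etgt e))
}.

Definition is_cocone (D : diagram) (X : ocat)
    (leg : forall v : vert D, functor (dobj v) X) : Prop :=
  forall e : edge D, leg (etgt e) \oF dmor e = leg (esrc e).

Definition is_colimit (D : diagram) (X : ocat)
    (leg : forall v : vert D, functor (dobj v) X) : Prop :=
  is_cocone leg /\
  forall (Y : ocat) (leg' : forall v : vert D, functor (dobj v) Y),
    is_cocone leg' ->
    exists! F : functor X Y, forall v, F \oF leg v = leg' v.

(** A colimit of each diagram: formal composites of cells of the objects of
    the diagram, identified when they have the same value in every cocone. *)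

Section Colimit.
Variable D : diagram.

Inductive cterm :=
  | CGen (v : vert D) (x : dobj v)
  | CComp (n : nat) (s t : cterm).

Record cocone := Cocone {
  capex :> ocat;
  cleg : forall v : vert D, functor (dobj v) capex;
  clegP : is_cocone cleg
}.

Fixpoint ceval (X : cocone) (t : cterm) : X :=
  match t with
  | CGen v x => cleg X v x
  | CComp n s t => ocomp n (ceval X s) (ceval X t)
  end.

Fixpoint cvalid (t : cterm) : Prop :=
  match t with
  | CGen _ _ => True
  | CComp n s t => [/\ cvalid s, cvalid t &
      forall X, tgt n (ceval X s) = src n (ceval X t)]
  end.

Definition ceq (s t : cterm) : Prop := forall X, ceval X s = ceval X t.

Definition ccell : Type :=
  {c : cterm -> Prop | exists2 t, cvalid t & c = ceq t}.

Definition ccls (t : cterm) (tv : cvalid t) : ccell :=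
  exist _ (ceq t) (ex_intro2 _ _ t tv erefl).

Definition crep (c : ccell) : cterm := projT1 (cid2 (svalP c)).

Definition cval (X : cocone) (c : ccell) : X := ceval X (crep c).

Lemma crepP c : cvalid (crep c).
Proof. by rewrite /crep; case: cid2. Qed.

Lemma crepE c : sval c = ceq (crep c).
Proof. by rewrite /crep; case: cid2. Qed.

Lemma cval_cls X t (tv : cvalid t) : cval X (ccls tv) = ceval X t.
Proof.
have : ceq (crep (ccls tv)) t by rewrite -crepE.
exact.
Qed.

Lemma ccell_eq c d : (forall X, cval X c = cval X d) -> c = d.
Proof.
move=> h; have e : sval c = sval d.
  rewrite !crepE; apply/funext => t; apply/propext.
  by split=> e X; rewrite -e; [apply/esym/h | apply: h].
by case: c d e {h} => c cP [d dP] /= e; subst d; congr exist; apply: Prop_irrelevance.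
Qed.

Fixpoint csrct (m : nat) (t : cterm) : cterm :=
  match t with
  | CGen v x => CGen (src m x)
  | CComp n s t => if m < n then csrct m s else
                   if m == n then csrct m s else CComp n (csrct m s) (csrct m t)
  end.

Fixpoint ctgtt (m : nat) (t : cterm) : cterm :=
  match t with
  | CGen v x => CGen (tgt m x)
  | CComp n s t => if m < n then ctgtt m s else
                   if m == n then ctgtt m t else CComp n (ctgtt m s) (ctgtt m t)
  end.

Lemma src_comp_gt (C : ocat) m n (x y : C) : m < n -> tgt n x = src n y ->
  src m (ocomp n x y) = src m x.
Proof. by move=> mn xy; rewrite -(src_src_lt _ mn) src_comp // src_src_lt. Qed.

Lemma tgt_comp_gt (C : ocat) m n (x y : C) : m < n -> tgt n x = src n y ->
  tgt m (ocomp n x y) = tgt m x.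
Proof. by move=> mn xy; rewrite -(tgt_src_lt _ mn) src_comp // tgt_src_lt. Qed.

Lemma csrctP m t : cvalid t ->
  cvalid (csrct m t) /\ forall X, ceval X (csrct m t) = src m (ceval X t).
Proof.
elim: t => [v x _|n s IHs t IHt [sv tv st]] /=.
  by split=> // X; rewrite fmap_src.
have [sv' es] := IHs sv; have [tv' et] := IHt tv.
case: ltngtP => mn /=; last subst n; split=> //.
- by move=> X; rewrite es src_comp_gt.
- by split=> // X; rewrite es et tgt_src_lt // src_src_lt.
- by move=> X; rewrite es et src_comp_lt.
- by move=> X; rewrite es src_comp.
Qed.

Lemma ctgttP m t : cvalid t ->
  cvalid (ctgtt m t) /\ forall X, ceval X (ctgtt m t) = tgt m (ceval X t).
Proof.
elim: t => [v x _|n s IHs t IHt [sv tv st]] /=.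
  by split=> // X; rewrite fmap_tgt.
have [sv' es] := IHs sv; have [tv' et] := IHt tv.
case: ltngtP => mn /=; last subst n; split=> //.
- by move=> X; rewrite es tgt_comp_gt.
- by split=> // X; rewrite es et tgt_tgt_lt // src_tgt_lt.
- by move=> X; rewrite es et tgt_comp_lt.
- by move=> X; rewrite et tgt_comp.
Qed.

Definition csrc m (c : ccell) : ccell := ccls (csrctP m (crepP c)).1.
Definition ctgt m (c : ccell) : ccell := ccls (ctgttP m (crepP c)).1.

Definition ccomp n (c d : ccell) : ccell :=
  match pselect (cvalid (CComp n (crep c) (crep d))) with
  | left v => ccls v
  | right _ => c
  end.

Lemma cval_src X m c : cval X (csrc m c) = src m (cval X c).
Proof. by rewrite cval_cls (csrctP m (crepP c)).2. Qed.

Lemma cval_tgt X m c : cval X (ctgt m c) = tgt m (cval X c).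
Proof. by rewrite cval_cls (ctgttP m (crepP c)).2. Qed.

Lemma cval_comp X n c d : ctgt n c = csrc n d ->
  cval X (ccomp n c d) = ocomp n (cval X c) (cval X d).
Proof.
move=> cd; rewrite /ccomp; case: pselect => [v|]; first by rewrite cval_cls.
case; split=> [||Y]; try exact: crepP.
by rewrite -!/(cval _ _) -cval_src -cval_tgt cd.
Qed.

Lemma ccell_findim c : exists n, csrc n c = c.
Proof.
have h t : cvalid t -> exists n, forall X, src n (ceval X t) = ceval X t.
  elim: t => [v x _|n s IHs t IHt [/IHs[p ps] /IHt[q qt] st]] /=.
    have [n xn] := cell_findim x; exists n => X.
    by rewrite -fmap_src xn.
  exists (maxn n.+1 (maxn p q)) => X.
  rewrite src_comp_lt ?leq_maxl // -{1}ps -{1}qt !src_src_le ?ps ?qt //;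
    lia.
have [n hn] := h _ (crepP c); exists n; apply: ccell_eq => X.
by rewrite cval_src hn.
Qed.

Lemma cval_tgt_src X n c d : ctgt n c = csrc n d ->
  tgt n (cval X c) = src n (cval X d).
Proof. by move=> cd; rewrite -cval_src -cval_tgt cd. Qed.

Lemma ccell_tgt_src n c d :
  (forall X, tgt n (cval X c) = src n (cval X d)) -> ctgt n c = csrc n d.
Proof. by move=> h; apply: ccell_eq => X; rewrite cval_src cval_tgt h. Qed.

Lemma colim_laws : ocat_laws csrc ctgt ccomp.
Proof.
split.
- by move=> *; apply: ccell_eq => X; rewrite !cval_src src_src_le.
- by move=> *; apply: ccell_eq => X; rewrite !(cval_src, cval_tgt) tgt_src_le.
- by move=> *; apply: ccell_eq => X; rewrite !(cval_src, cval_tgt) src_tgt_le.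
- by move=> *; apply: ccell_eq => X; rewrite !cval_tgt tgt_tgt_le.
- by move=> *; apply: ccell_eq => X; rewrite !cval_src src_src_lt.
- by move=> *; apply: ccell_eq => X; rewrite !(cval_src, cval_tgt) src_tgt_lt.
- by move=> *; apply: ccell_eq => X; rewrite !(cval_src, cval_tgt) tgt_src_lt.
- by move=> *; apply: ccell_eq => X; rewrite !cval_tgt tgt_tgt_lt.
- move=> n x y xy; apply: ccell_eq => X.
  by rewrite !(cval_src, cval_comp) // src_comp //; apply: cval_tgt_src.
- move=> n x y xy; apply: ccell_eq => X.
  by rewrite !(cval_tgt, cval_comp) // tgt_comp //; apply: cval_tgt_src.
- move=> m n x y mn xy; have xy' X := cval_tgt_src X xy.
  apply: ccell_eq => X; rewrite cval_src !cval_comp ?cval_src ?src_comp_lt //.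
  by apply: ccell_tgt_src => Y; rewrite !cval_src tgt_src_lt ?src_src_lt.
- move=> m n x y mn xy; have xy' X := cval_tgt_src X xy.
  apply: ccell_eq => X; rewrite cval_tgt !cval_comp ?cval_tgt ?tgt_comp_lt //.
  by apply: ccell_tgt_src => Y; rewrite !cval_tgt tgt_tgt_lt ?src_tgt_lt.
- move=> n x; apply: ccell_eq => X; rewrite cval_comp ?cval_src ?comp_srcl //.
  by apply: ccell_tgt_src => Y; rewrite cval_src tgt_src_le.
- move=> n x; apply: ccell_eq => X; rewrite cval_comp ?cval_tgt ?comp_tgtr //.
  by apply: ccell_tgt_src => Y; rewrite cval_tgt src_tgt_le.
- move=> n x y z xy yz.
  have xy' X := cval_tgt_src X xy; have yz' X := cval_tgt_src X yz.
  apply: ccell_eq => X; rewrite !cval_comp ?compA //; apply: ccell_tgt_src => Y.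
    by rewrite cval_comp // tgt_comp.
  by rewrite cval_comp // src_comp.
- move=> m n x y z w mn xy zw xz.
  have xy' X := cval_tgt_src X xy; have zw' X := cval_tgt_src X zw.
  have xz' X := cval_tgt_src X xz.
  have yw' X : tgt m (cval X y) = src m (cval X w).
    by rewrite -(tgt_src_lt _ mn) -xy' tgt_tgt_lt // xz' -(src_src_lt _ mn)
       -(src_src_lt (cval X w) mn) -zw' !(src_src_lt, src_tgt_lt).
  have yw : ctgt m y = csrc m w by apply: ccell_tgt_src.
  apply: ccell_eq => X; rewrite !cval_comp //.
  + by rewrite (comp_interchange mn).
  + apply: ccell_tgt_src => Y; rewrite !cval_comp //.
    by rewrite tgt_comp_lt // src_comp_lt // xy' zw'.
  + apply: ccell_tgt_src => Y; rewrite !cval_comp //.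
    by rewrite tgt_comp_gt // src_comp_gt.
- exact: ccell_findim.
Qed.

Definition colim : ocat := Ocat colim_laws.

Definition cgen (v : vert D) (x : dobj v) : ccell := @ccls (CGen x) I.

Lemma cval_gen X v (x : dobj v) : cval X (cgen x) = cleg X v x.
Proof. exact: cval_cls. Qed.

Lemma cgen_laws (v : vert D) : @functor_laws (dobj v) colim (@cgen v).
Proof.
split=> [n x|n x|n x y xy];
  apply: ccell_eq => X.
- by rewrite cval_src !cval_gen fmap_src.
- by rewrite cval_tgt !cval_gen fmap_tgt.
- rewrite cval_comp ?cval_gen ?fmap_comp //.
  by apply: ccell_tgt_src => Y; rewrite !cval_gen -fmap_src -fmap_tgt xy.
Qed.

Definition colim_in (v : vert D) : functor (dobj v) colim :=
  Functor (cgen_laws v).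

End Colimit.

(** * The three columns

    Everything is stated for a family of omega-categories A_1,...,A_n with
    chosen cylinders [1] (x) A_k and maps kappa_k, sigma_k, to be instantiated
    recursively with cells of Theta.  The index [k : 'I_n] stands for k+1, so
    that P_(k-1) and P_k become [Pcat (olo k)] and [Pcat (ohi k)]. *)

Definition olo n (k : 'I_n) : 'I_n.+1 := widen_ord (leqnSn n) k.
Definition ohi n (k : 'I_n) : 'I_n.+1 := lift ord0 k.

(** [cyl_end e] is {e} (x) C : C -> [1] (x) C. *)
Record cylinder (C : ocat) := Cylinder {
  cyl :> ocat;
  cyl_end : bool -> functor C cyl
}.

(** {e} x C : C -> [1] x C. *)
Definition prod_end (C : ocat) (e : bool) : functor C (oprod arrow C) :=
  pairF (endF pt e \oF bang C) (idF C).

Section Columns.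
Variables (n : nat) (A : 'I_n -> ocat) (G : forall k, cylinder (A k)).

Definition Tcat : ocat := bracket A.
Definition Pcat (j : 'I_n.+1) : ocat := bracket (insert j A).

Definition repl (k i : 'I_n) : ocat := if i == k then cyl (G i) else A i.
Definition Qcat (k : 'I_n) : ocat := bracket (repl k).

Lemma repl_at k : repl k k = cyl (G k).
Proof. by rewrite /repl eqxx. Qed.

Definition E_to_Q (e : bool) (k : 'I_n) : functor Tcat (Qcat k) :=
  bmap_id (D := repl k) (fun i =>
    if i == k as b return functor (A i) (if b then cyl (G i) else A i)
    then cyl_end (G i) e else idF (A i)).

(** d^k;(id,...,(!,id),...,id) and d^k;(id,...,(id,!),...,id), used both from
    E_k^+, E_k^- and from M_k. *)
Definition T_to_Plo (k : 'I_n) : functor Tcat (Pcat (olo k)) := face_hi A (olo k).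
Definition T_to_Phi (k : 'I_n) : functor Tcat (Pcat (ohi k)) := face_lo A (ohi k).

Inductive mid_vert :=
  MP of 'I_n.+1 | MQ of 'I_n | MEplus of 'I_n | MEminus of 'I_n.
Inductive mid_edge :=
  EplusP of 'I_n | EplusQ of 'I_n | EminusQ of 'I_n | EminusP of 'I_n.

Definition mid_obj (v : mid_vert) : ocat :=
  match v with
  | MP j => Pcat j | MQ k => Qcat k | MEplus k => Tcat | MEminus k => Tcat
  end.

Definition mid_src (a : mid_edge) : mid_vert :=
  match a with
  | EplusP k => MEplus k | EplusQ k => MEplus k
  | EminusQ k => MEminus k | EminusP k => MEminus k
  end.

Definition mid_tgt (a : mid_edge) : mid_vert :=
  match a with
  | EplusP k => MP (olo k) | EplusQ k => MQ k
  | EminusQ k => MQ k | EminusP k => MP (ohi k)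
  end.

Definition mid_mor (a : mid_edge) :
    functor (mid_obj (mid_src a)) (mid_obj (mid_tgt a)) :=
  match a with
  | EplusP k => T_to_Plo k
  | EplusQ k => E_to_Q false k
  | EminusQ k => E_to_Q true k
  | EminusP k => T_to_Phi k
  end.

Definition mid_column : diagram := Diagram mid_mor.

Inductive left_vert := LP of 'I_n.+1 | LM of 'I_n.
Inductive left_edge := MPlo of 'I_n | MPhi of 'I_n.

Definition left_obj (v : left_vert) : ocat :=
  match v with LP j => Pcat j | LM k => Tcat end.

Definition left_src (a : left_edge) : left_vert :=
  match a with MPlo k => LM k | MPhi k => LM k end.

Definition left_tgt (a : left_edge) : left_vert :=
  match a with MPlo k => LP (olo k) | MPhi k => LP (ohi k) end.

Definition left_mor (a : left_edge) :
    functor (left_obj (left_src a)) (left_obj (left_tgt a)) :=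
  match a with MPlo k => T_to_Plo k | MPhi k => T_to_Phi k end.

Definition left_column : diagram := Diagram left_mor.

(** split^(j+1);(!) : P_j -> [1];([0]). *)
Definition P_split (j : 'I_n.+1) : functor (Pcat j) arrow :=
  splitF (C := insert j A) (j := j) (bang _).

Definition left_leg (v : vert left_column) :
    functor (dobj v) (oprod arrow Tcat) :=
  let legP j := pairF (P_split j) (collapse A j) in
  match v return functor (left_obj v) (oprod arrow Tcat) with
  | LP j => legP j
  | LM k => legP (olo k) \oF T_to_Plo k
  end.

Inductive right_vert := RO of 'I_n.+1 | RN of 'I_n.
Inductive right_edge := ONlo of 'I_n | ONhi of 'I_n.

Definition right_obj (v : right_vert) : ocat :=
  match v with RO j => susp pt | RN k => susp (susp (A k)) end.

Definition right_src (a : right_edge) : right_vert :=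
  match a with ONlo k => RO (olo k) | ONhi k => RO (ohi k) end.

Definition right_tgt (a : right_edge) : right_vert :=
  match a with ONlo k => RN k | ONhi k => RN k end.

Definition O_to_N (e : bool) (k : 'I_n) :
  functor (susp pt) (susp (susp (A k))) := suspF (endF (A k) e).

Definition right_mor (a : right_edge) :
    functor (right_obj (right_src a)) (right_obj (right_tgt a)) :=
  match a with ONlo k => O_to_N false k | ONhi k => O_to_N true k end.

Definition right_column : diagram := Diagram right_mor.

Definition right_leg (v : vert right_column) : functor (dobj v) (susp Tcat) :=
  match v return functor (right_obj v) (susp Tcat) with
  | RO j => suspF (objF A j)
  | RN k => suspF (edgeF A k)
  end.

(** Q_k -> M_k : id;(id,...,pr_2 o kappa_k,...,id). *)
Definition Q_to_M (kappa : forall k, functor (G k) (oprod arrow (A k)))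
    (k : 'I_n) : functor (Qcat k) Tcat :=
  bmap_id (C := repl k) (fun i =>
    if i == k as b return functor (if b then cyl (G i) else A i) (A i)
    then pr2 _ _ \oF kappa i else idF (A i)).

(** Q_k -> [1];([1];(A_k)) : split^k;(sigma_k). *)
Definition Q_to_N (sigma : forall k, functor (G k) (susp (A k)))
    (k : 'I_n) : functor (Qcat k) (susp (susp (A k))) :=
  splitF (C := repl k) (sigma k \oF castF (repl_at k)).

Definition mid_cylinder : cylinder Tcat :=
  @Cylinder Tcat (colim mid_column) (fun e =>
    if e then colim_in (D := mid_column) (MP ord0) \oF face_lo A ord0
    else colim_in (D := mid_column) (MP ord_max) \oF face_hi A ord_max).

(** [F] is induced by the maps from the middle to the left (right) column. *)

Definition induced_left kappa (F : functor mid_cylinder (oprod arrow Tcat)) : Prop :=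
  (forall j, F \oF colim_in (D := mid_column) (MP j) = left_leg (LP j)) /\
  (forall k, F \oF colim_in (D := mid_column) (MQ k) =
             left_leg (LM k) \oF Q_to_M kappa k).

Definition induced_right sigma (F : functor mid_cylinder (susp Tcat)) : Prop :=
  (forall j, F \oF colim_in (D := mid_column) (MP j) =
             right_leg (RO j) \oF P_split j) /\
  (forall k, F \oF colim_in (D := mid_column) (MQ k) =
             right_leg (RN k) \oF Q_to_N sigma k).

End Columns.

Inductive theta := Cell (n : nat) (A : 'I_n -> theta).

Fixpoint realize (S : theta) : ocat :=
  match S with Cell n A => bracket (fun k => realize (A k)) end.

(** [1] (x) T.  For T = [0] the middle column is the single object
    P_0 = [1];([0]) = [1], so [gray] is [1] up to the canonical isomorphism
    [colim_in], under which kappa and sigma become identities. *)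
Fixpoint gray (S : theta) : cylinder (realize S) :=
  match S with Cell n A => mid_cylinder (fun k => gray (A k)) end.

(** Some functor with property [X]; the default [F0] is used only if there is
    none.  Below, [X] is the defining property of an induced map, which has
    exactly one solution. *)
Definition the_functor (C D : ocat) (F0 : functor C D)
    (X : functor C D -> Prop) : functor C D :=
  if pselect (exists F, X F) is left e then projT1 (cid e) else F0.

Fixpoint kappa (S : theta) : functor (gray S) (oprod arrow (realize S)) :=
  match S with
  | Cell n A =>
    the_functor (pairF (endF pt false) (objF _ ord0) \oF bang _)
      (induced_left (fun k => kappa (A k)))
  end.

Fixpoint sigma (S : theta) : functor (gray S) (susp (realize S)) :=
  match S with
  | Cell n A =>
    the_functor (endF _ false \oF bang _)
      (induced_right (fun k => sigma (A k)))
  end.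

(* Main.v *)
Require Import Defs.
From mathcomp Require Import all_boot.
From mathcomp Require Import boolp zify.

Set Implicit Arguments.
Unset Strict Implicit.
Unset Printing Implicit Defensive.

(** Left column: each P_j embeds in [1] x T, every composable pair of cells of
    [1] x T lies in a single P_j, and a cell lying in both P_j and P_(j+1)
    comes from the copy of T between them; so a cocone glues uniquely, with no
    composites to choose.

    Right column: a cell (a_(i+1), ..., a_j) of Hom(i,j) in T gives the cell of
    [1];(T) that is the composite, along dimension 1, of the cells given by
    the a_k, each of which comes from [1];([1];(A_k)).  The value of the induced functor is therefore
    the iterated 1-composite of the values of the cocone, and functoriality is
    the interchange law.

    The compatibilities only use that kappa and sigma of the A_k have the
    expected restrictions to the two ends, which is part (3) for the A_k. *)

(** * Casts and evaluation of functors *)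

(** Equality proofs are irrelevant, so the casts built into [bmap_id], [splitF] and [edgeF]
    disappear once their components are evaluated at the edge concerned. *)
Lemma castF_id (C : ocat) (e : C = C) : castF e = idF C.
Proof. by rewrite (Prop_irrelevance e erefl). Qed.

Lemma castF_inj (C D : ocat) (e : C = D) : injective (castF e).
Proof. by case: D / e => x y. Qed.

Lemma compFE (C D E : ocat) (F : functor D E) (G : functor C D) x :
  (F \oF G) x = F (G x).
Proof. by []. Qed.

Lemma fmap_eq (C D : ocat) (F G : functor C D) (x : C) : F = G -> F x = G x.
Proof. by move=> ->. Qed.

(** * Colimits *)

(** [ccomp] works with chosen representatives, which need not be [s] and [t]; the classes still
    agree because only values in cocones count. *)
Lemma ccls_comp (D : diagram) n (s t : cterm D) (v : cvalid (CComp n s t))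
    (sv : cvalid s) (tv : cvalid t) :
  ctgt n (ccls sv) = csrc n (ccls tv) /\
  ccls v = ccomp n (ccls sv) (ccls tv).
Proof.
have st : ctgt n (ccls sv) = csrc n (ccls tv).
  by apply: ccell_tgt_src => X; rewrite !cval_cls; case: v.
by split=> //; apply: ccell_eq => X; rewrite cval_comp // !cval_cls.
Qed.

Lemma colim_is_colimit (D : diagram) :
  is_colimit (X := colim D) (colim_in (D := D)).
Proof.
split=> [e|Y leg legP].
  apply: functor_ext => x; apply: ccell_eq => X /=.
  by rewrite !cval_gen -(fmap_eq x (clegP X e)).
pose X := Cocone legP.
have FP : @functor_laws (colim D) (capex X) (@cval D X).
  by split=> *; rewrite /= ?cval_src ?cval_tgt ?cval_comp.
exists (Functor FP); split=> [v|F' F'P].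
  by apply: functor_ext => x; rewrite -[RHS]/(cleg X v x) -cval_gen.
(* Every cell is the class of a formal composite of generators, so induction on terms pins down any
   competing functor. *)
have F'E t (tv : cvalid t) : F' (ccls tv) = ceval X t.
  elim: t tv => [v x tv|n s IHs t IHt tv].
    by rewrite /= -F'P; congr (F' _); apply: ccell_eq => Z; rewrite cval_gen cval_cls.
  have [sv' tv' _] := tv.
  have [st ->] := ccls_comp tv sv' tv'.
  by rewrite [LHS](fmap_comp F' st) IHs IHt.
apply: functor_ext => c; rewrite -[RHS]/(F' c).
suff -> : c = ccls (crepP c) by rewrite F'E /= cval_cls.
by apply: ccell_eq => Z; rewrite cval_cls.
Qed.

(** Preimages under the legs define the functor: the last hypothesis makes their choice immaterial,
    and lifting composable pairs inside one vertex makes it preserve composition. *)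
Lemma cover_colimit (D : diagram) (X : ocat)
    (leg : forall v : vert D, functor (dobj v) X) :
  is_cocone leg ->
  (forall n c d, tgt n c = src n d -> exists v (z w : dobj v),
    [/\ tgt n z = src n w, leg v z = c & leg v w = d]) ->
  (forall (Y : ocat) (leg' : forall v : vert D, functor (dobj v) Y),
    is_cocone leg' -> forall v v' (z : dobj v) (z' : dobj v'),
    leg v z = leg v' z' -> leg' v z = leg' v' z') ->
  is_colimit leg.
Proof.
move=> legP cover glue; split=> // Y leg' leg'P.
have lift c : exists vz : {v : vert D & dobj v}, leg (projT1 vz) (projT2 vz) = c.
  (* Pairing [c] with its own 0-target lets the covering hypothesis lift single cells too. *)
  have cc : tgt 0 c = src 0 (tgt 0 c) by rewrite src_tgt_le.
  by have [v [z [w [_ zc _]]]] := cover _ _ _ cc; exists (existT _ v z).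
have [l lP] := choice lift.
pose f c := leg' (projT1 (l c)) (projT2 (l c)).
have fE v z : f (leg v z) = leg' v z by apply: glue; rewrite // lP.
have fP : functor_laws f.
  split=> [n c|n c|n c d cd].
  - have [[v z] /= <-] := lift c.
    by rewrite -fmap_src !fE fmap_src.
  - have [[v z] /= <-] := lift c.
    by rewrite -fmap_tgt !fE fmap_tgt.
  - have [v [z [w [zw <- <-]]]] := cover _ _ _ cd.
    by rewrite -fmap_comp // !fE fmap_comp.
exists (Functor fP); split=> [v|F FP].
  by apply: functor_ext => z; apply: fE.
apply: functor_ext => c; have [[v z] /= <-] := lift c.
by rewrite fE -FP.
Qed.

(** * Faces, degeneracies and splits *)

Lemma to_insertK (I : Type) (A : I -> ocat) (i : I) (o : option I)
    (h : forall k, o = Some k -> i = k) (e : o = Some i) (a : A i) :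
  from_insert A e (to_insert A h a) = a.
Proof.
subst o; rewrite /= (Prop_irrelevance (h i erefl) erefl).
by [].
Qed.

Lemma endptE e : endpt e = e :> nat.
Proof. by case: e. Qed.

Lemma endpt_inj : injective endpt.
Proof. by move=> [] []. Qed.

(** The components lie in [pt], and their presence is dictated by the endpoints. *)
Lemma arrow_eq (x y : arrow) : bdom x = bdom y -> bcod x = bcod y -> x = y.
Proof.
move=> xd xc; apply: bcell_eq => // k.
by move: (bvalP x k) (bvalP y k); rewrite xd xc; case: bval => [[]|];
  case: bval => [[]|] // <-.
Qed.

Lemma bmap_idE n (C D : 'I_n -> ocat) (g : forall i, functor (C i) (D i))
    (x : bracket C) k : bval (bmap_id g x) k = omap (g k) (bval x k).
Proof.
have kk : inspan (did n) k k by rewrite /inspan /= /bump /=; lia.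
rewrite /= (bmap_valE _ _ kk) castF_id.
by case: bval.
Qed.

Section Splits.
Variables (m : nat) (C : 'I_m -> ocat) (D : ocat) (j : 'I_m).
Variable g : functor (C j) D.

Lemma splitF_dom (x : bracket C) : bdom (splitF g x) = endpt (j < bdom x).
Proof. by []. Qed.

Lemma splitF_cod (x : bracket C) : bcod (splitF g x) = endpt (j < bcod x).
Proof. by []. Qed.

Lemma splitF_val (x : bracket C) l : bval (splitF g x) l = omap g (bval x j).
Proof.
have jl : inspan (dsplit j) j l.
  by rewrite /inspan /= !endptE ord1 /= /bump /=; lia.
rewrite /= (bmap_valE _ _ jl); case: bval => //= a.
by rewrite castF_id.
Qed.

End Splits.

Section Faces.
Variables (n : nat) (A : 'I_n -> ocat).

Lemma collapse_dom j (z : bracket (insert j A)) :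
  bdom (collapse A j z) = unbump j (bdom z) :> nat.
Proof.
by rewrite /= inordK // /unbump; have := ltn_ord (bdom z); have := ltn_ord j; lia.
Qed.

Lemma collapse_cod j (z : bracket (insert j A)) :
  bcod (collapse A j z) = unbump j (bcod z) :> nat.
Proof.
by rewrite /= inordK // /unbump; have := ltn_ord (bcod z); have := ltn_ord j; lia.
Qed.

Lemma inspan_ddegen_lift (j l : 'I_n.+1) (k : 'I_n) :
  unlift j l = Some k -> inspan (ddegen j) l k.
Proof.
case: unliftP => // k' -> [->]; have := ltn_ord j; have := ltn_ord k.
by rewrite /inspan /= => *; rewrite !inordK /unbump /= /bump /=; lia.
Qed.

Lemma collapse_val j (z : bracket (insert j A)) (l : 'I_n.+1) (k : 'I_n)
    (lk : unlift j l = Some k) :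
  bval (collapse A j z) k = omap (from_insert A lk) (bval z l).
Proof.
rewrite /= (bmap_valE _ _ (inspan_ddegen_lift lk)).
by congr (omap (fmap (from_insert A _)) _); apply: Prop_irrelevance.
Qed.

(** Collapsing the inserted edge identifies the objects [j] and [j.+1], so it retracts both faces
    that omit one of these two. *)
Lemma collapse_faceF (j : 'I_n.+1) (p : 'I_n.+2) (jp : (j <= p <= j.+1)%N) x :
  collapse A j (faceF A jp x) = x.
Proof.
apply: bcell_eq.
- apply: val_inj; rewrite /= inordK /unbump /= /bump;
    have := ltn_ord (bdom x); lia.
- apply: val_inj; rewrite /= inordK /unbump /= /bump;
    have := ltn_ord (bcod x); lia.
move=> k.
have kj : inspan (dface p) k (lift j k).
  by rewrite /inspan /= /bump /=; have := ltn_ord k; lia.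
rewrite (collapse_val _ (liftK j k)) [bval (faceF _ _ _) _](bmap_valE _ _ kj).
case: (bval x k) => //= a; congr Some.
exact: to_insertK.
Qed.

(** An object of P_j is the sum of its collapse and its side of the inserted edge, so the endpoints
    are recovered; the components other than the inserted one survive the collapse. *)
Lemma P_cell_inj (j : 'I_n.+1) (z w : Pcat A j) :
  P_split A j z = P_split A j w -> collapse A j z = collapse A j w -> z = w.
Proof.
move=> szw czw.
have dzw : bdom z = bdom w.
  have := congr1 (@bdom _ _) szw; rewrite !splitF_dom => /endpt_inj s.
  have := congr1 (fun c => bdom c : nat) czw; rewrite !collapse_dom /unbump => c.
  by apply: val_inj => /=; lia.
have cdw : bcod z = bcod w.
  have := congr1 (@bcod _ _) szw; rewrite !splitF_cod => /endpt_inj s.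
  have := congr1 (fun c => bcod c : nat) czw; rewrite !collapse_cod /unbump => c.
  by apply: val_inj => /=; lia.
apply: bcell_eq => // l.
have: isSome (bval z l) = isSome (bval w l) by rewrite !bvalP dzw cdw.
case E : (unlift j l) => [k|].
  have := congr1 (fun c => bval c k) czw; rewrite !(collapse_val _ E).
  case: (bval z l) => [a|]; case: (bval w l) => [b|] // [ab] _.
  by congr Some; apply: castF_inj ab.
(* On the inserted edge the component lies in [pt]. Arbitrary options are used so that rewriting
   with [E] can change their type. *)
have u (s t : option (insert j A l)) : isSome s = isSome t -> s = t.
  move: s t; rewrite /insert E.
  by case=> [[]|] [[]|].
exact: u.
Qed.

End Faces.

(** * The left column *)

Section LeftColumn.
Variables (n : nat) (A : 'I_n -> ocat).

(** Both faces omit the object [k.+1], the only one on which the two splitting tests differ. *)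
Lemma P_split_Plo_Phi (k : 'I_n) x :
  P_split A (olo k) (T_to_Plo A k x) = P_split A (ohi k) (T_to_Phi A k x).
Proof.
by apply: arrow_eq; rewrite !splitF_dom || rewrite !splitF_cod; congr endpt;
  rewrite /= /bump /=; lia.
Qed.

Lemma left_leg_cocone : is_cocone (D := left_column A) (left_leg (A := A)).
Proof.
case=> k //; apply: functor_ext => x; congr pair; first exact/esym/P_split_Plo_Phi.
exact: etrans (collapse_faceF _ _) (esym (collapse_faceF _ _)).
Qed.

(** The image of P_j in [1] x T. *)
Definition in_P (j : 'I_n.+1) (u : arrow) (x : bracket A) : bool :=
  (if bdom u == 0 :> nat then bdom x <= j else j <= bdom x) &&
  (if bcod u == 0 :> nat then bcod x <= j else j <= bcod x).

Lemma in_P_image (j : 'I_n.+1) (z : Pcat A j) :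
  in_P j (P_split A j z) (collapse A j z).
Proof.
rewrite /in_P collapse_dom collapse_cod !splitF_dom !splitF_cod !endptE /unbump.
by case: (ltnP j (bdom z)); case: (ltnP j (bcod z)) => /=; lia.
Qed.

(** The option [o] generalises [unlift j l], so that it can be destructed together with the type
    that depends on it. *)
Definition insert_val (v : forall k, option (A k)) (b : option unit)
    (o : option 'I_n) : option (oapp A pt o) :=
  match o with Some k => v k | None => b end.

Lemma arrow_dom_le1 (u : arrow) : bdom u <= 1.
Proof. by have := ltn_ord (bdom u); lia. Qed.

Lemma arrow_cod_le1 (u : arrow) : bcod u <= 1.
Proof. by have := ltn_ord (bcod u); lia. Qed.

Lemma ord_eq0E (i : 'I_2) : i = endpt (0 < i).
Proof. by apply: ord_inj; rewrite endptE; case: i => [[|[]]]. Qed.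

Lemma P_lift (j : 'I_n.+1) (u : arrow) (x : bracket A) : in_P j u x ->
  exists z : Pcat A j, P_split A j z = u /\ collapse A j z = x.
Proof.
move=> /andP[dP cP].
(* The object (e, i) of [1] x T sits in P_j as i + e: crossing the inserted edge shifts by one. *)
pose a : 'I_n.+2 := inord (bdom x + bdom u).
pose b : 'I_n.+2 := inord (bcod x + bcod u).
have hd := ltn_ord (bdom x); have hc := ltn_ord (bcod x).
have ud := arrow_dom_le1 u; have uc := arrow_cod_le1 u.
have aE : a = bdom x + bdom u :> nat by rewrite inordK //; lia.
have bE : b = bcod x + bcod u :> nat by rewrite inordK //; lia.
have xle := bdom_le x; have ule := bdom_le u.
have ab : a <= b by rewrite aE bE; lia.
pose v (l : 'I_n.+1) : option (insert j A l) :=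
  insert_val (bval x) (if a <= l < b then Some tt else None) (unlift j l).
have vP l : isSome (v l) = (a <= l < b).
  rewrite /v /insert; case: unliftP => [k ->|_] /=; last by case: ifP.
  rewrite bvalP aE bE /= /bump.
  by move: dP cP; case: eqP; case: eqP => *; lia.
exists (BCell ab vP : Pcat A j); split.
  apply: arrow_eq; rewrite ?splitF_dom ?splitF_cod /= [RHS]ord_eq0E; congr endpt.
    by rewrite aE; move: dP; case: eqP => *; lia.
  by rewrite bE; move: cP; case: eqP => *; lia.
apply: bcell_eq.
- by apply: ord_inj; rewrite collapse_dom /= aE /unbump; move: dP; case: eqP => *; lia.
- by apply: ord_inj; rewrite collapse_cod /= bE /unbump; move: cP; case: eqP => *; lia.
move=> k; rewrite (collapse_val _ (liftK j k)) /= /v.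
have gen o (e : o = Some k) c :
    omap (from_insert A e) (insert_val (bval x) c o) = bval x k.
  by subst o; rewrite /from_insert castF_id /=; case: bval.
exact: gen.
Qed.

(** The endpoints of a composable pair form a nondecreasing chain in [1] x [n]. Any height at which
    the chain may pass from the level 0 to the level 1 serves as [j]. *)
Lemma in_P_composable m (u v : arrow) (x y : bracket A) :
  tgt m u = src m v -> tgt m x = src m y -> exists j, in_P j u x && in_P j v y.
Proof.
have xle := bdom_le x; have ule := bdom_le u.
have yle := bdom_le y; have vle := bdom_le v.
case: m => [|m] uv xy; last first.
  have du : bdom u = bdom v by have := congr1 (@bdom _ _) uv.
  have cu : bcod u = bcod v by have := congr1 (@bcod _ _) uv.
  have dx : bdom x = bdom y by have := congr1 (@bdom _ _) xy.
  have cx : bcod x = bcod y by have := congr1 (@bcod _ _) xy.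
  (* Above dimension 0 both cells have the same endpoints: take the upper height if the chain starts
     at level 0, else the lower one. *)
  exists (if bdom u == 0 :> nat then bcod x else bdom x).
  rewrite /in_P -du -dx -cu -cx.
  by do 2!case: eqP => *; lia.
have cu : bcod u = bdom v by have := congr1 (@bdom _ _) uv.
have cx : bcod x = bdom y by have := congr1 (@bdom _ _) xy.
(* The chain now has three members; the level of the middle one decides between the last height and
   the first. *)
exists (if bdom v == 0 :> nat then bcod y else bdom x).
rewrite /in_P cu -cx; rewrite cu in ule; rewrite -cx in yle *.
have ud := arrow_dom_le1 u; have vd := arrow_dom_le1 v.
by do 3!case: eqP => *; lia.
Qed.

(** Two cells with the same image are joined by moving from P_j to P_(j+1) through the copy of T
    between them, one step at a time; [glue] is the induction on the distance. *)
Lemma left_leg_glue (Y : ocat)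
    (leg : forall v : vert (left_column A), functor (dobj v) Y) :
  is_cocone leg -> forall v v' (z : dobj v) (z' : dobj v'),
  left_leg (A := A) v z = left_leg (A := A) v' z' -> leg v z = leg v' z'.
Proof.
move=> legP.
pose same (j : 'I_n.+1) (z : Pcat A j) (j' : 'I_n.+1) (z' : Pcat A j') :=
  P_split A j z = P_split A j' z' /\ collapse A j z = collapse A j' z'.
have glue m (j : 'I_n.+1) (z : Pcat A j) (j' : 'I_n.+1) (z' : Pcat A j') :
    same j z j' z' -> j' = j + m :> nat -> leg (LP j) z = leg (LP j') z'.
  elim: m j z => [|m IH] j z [sE cE] jj'.
    have {}jj' : j' = j by apply: val_inj; rewrite /= jj' addn0.
    by subst j'; congr (leg _ _); apply: P_cell_inj.
  have kP : j < n by have := ltn_ord j'; lia.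
  have [k jE] : exists k, j = olo k by exists (Ordinal kP); apply: val_inj.
  subst j; rewrite /= in jj'.
  pose x := collapse A (olo k) z.
  have kin := in_P_image z; have kin' := in_P_image z'; rewrite -sE -cE in kin'.
  (* As the image also lies in P_(j') with j' > k, it avoids the object (1, k), which is the one
     omitted by this face. *)
  have xlo : T_to_Plo A k x = z.
    apply: P_cell_inj; last exact: collapse_faceF.
    move: kin kin'; rewrite -/x /in_P => /andP[d c] /andP[d' c'].
    apply: arrow_eq; rewrite splitF_dom || rewrite splitF_cod;
      rewrite [RHS]ord_eq0E; congr endpt; rewrite /= /bump /=.
      by move: d d'; have := arrow_dom_le1 (P_split A (olo k) z);
        case: eqP => /= *; lia.
    by move: c c'; have := arrow_cod_le1 (P_split A (olo k) z);
      case: eqP => /= *; lia.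
  rewrite -xlo.
  have -> : leg (LP (olo k)) (T_to_Plo A k x) = leg (LP (ohi k)) (T_to_Phi A k x).
    exact: etrans (fmap_eq x (legP (MPlo k))) (esym (fmap_eq x (legP (MPhi k)))).
  apply: IH; last by move: jj'; rewrite /= /bump /=; lia.
  split; first by rewrite -P_split_Plo_Phi xlo.
  by rewrite -cE; exact: collapse_faceF.
have glueP (j j' : 'I_n.+1) (z : Pcat A j) (z' : Pcat A j') :
    same j z j' z' -> leg (LP j) z = leg (LP j') z'.
  move=> s; case: (leqP j j') => [jj'|/ltnW jj'].
    by apply: (glue (j' - j)) => //; lia.
  by apply/esym/(glue (j - j')); [case: s | lia].
(* The legs on the copies of T factor through the P_j, so only cells of the P_j need comparing. *)
pose toP (v : vert (left_column A)) : dobj v -> {j : 'I_n.+1 & Pcat A j} :=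
  match v return left_obj A v -> _ with
  | LP j => fun z => existT _ j z
  | LM k => fun x => existT _ (olo k) (T_to_Plo A k x)
  end.
have toPE v z : leg v z = leg (LP (projT1 (toP v z))) (projT2 (toP v z)).
  by case: v z => // k x; rewrite -[LHS](fmap_eq x (legP (MPlo k))).
move=> v v' z z'.
have toPl w y : left_leg (A := A) w y =
  left_leg (A := A) (LP (projT1 (toP w y))) (projT2 (toP w y)) by case: w y.
rewrite toPl [RHS]toPl (toPE v) (toPE v') => e; apply: glueP.
by split; [exact: (congr1 fst e) | exact: (congr1 snd e)].
Qed.

Lemma left_colimit : is_colimit (D := left_column A)
  (X := oprod arrow (bracket A)) (left_leg (A := A)).
Proof.
apply: cover_colimit left_leg_cocone _ left_leg_glue => m [u x] [v y] /= [uv xy].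
have [j /andP[/P_lift[z [zu zx]] /P_lift[w [wv wy]]]] := in_P_composable uv xy.
exists (LP j), z, w.
split; [|by rewrite -zu -zx|by rewrite -wv -wy].
(* Composability of the lifts is tested in [1] x T, by joint injectivity. *)
apply: P_cell_inj; rewrite fmap_tgt fmap_src; first by rewrite zu wv.
by rewrite zx wy.
Qed.

End LeftColumn.

(** * Iterated composites *)

Section PathComp.
Variables (Y : ocat) (q : nat).

(** The empty composite is the identity at the start of the path, which is why even length 0 refers
    to [h 0]. *)
Fixpoint path_comp (h : nat -> Y) (m : nat) : Y :=
  if m is m'.+1 then ocomp q (path_comp h m') (h m') else src q (h 0).

Definition composable (h : nat -> Y) := forall k, tgt q (h k) = src q (h k.+1).

Lemma eq_path_comp (h h' : nat -> Y) m : h =1 h' -> path_comp h m = path_comp h' m.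
Proof. by move=> hh'; elim: m => [|m IH] /=; rewrite ?IH hh'. Qed.

Lemma path_comp_tgt h m : composable h -> tgt q (path_comp h m) = src q (h m).
Proof.
by move=> hP; elim: m => [|m IH] /=; rewrite ?tgt_src_le // tgt_comp.
Qed.

Lemma path_comp_src h m : composable h -> src q (path_comp h m) = src q (h 0).
Proof.
move=> hP; elim: m => [|m IH] /=; first by rewrite src_src_le.
by rewrite src_comp // path_comp_tgt.
Qed.

Lemma src_path_comp p h m : q < p -> composable h ->
  src p (path_comp h m) = path_comp (fun k => src p (h k)) m.
Proof.
move=> qp hP; elim: m => [|m IH] /=; first by rewrite src_src_le ?src_src_lt // ltnW.
by rewrite src_comp_lt ?IH // path_comp_tgt.
Qed.

Lemma tgt_path_comp p h m : q < p -> composable h ->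
  tgt p (path_comp h m) = path_comp (fun k => tgt p (h k)) m.
Proof.
move=> qp hP; elim: m => [|m IH] /=.
  by rewrite tgt_src_le ?src_tgt_lt // ltnW.
by rewrite tgt_comp_lt ?IH // path_comp_tgt.
Qed.

(** One use of the interchange law per factor; in the empty case the two paths start at the same
    identity, since [h 0] and [h' 0] are composable above dimension [q]. *)
Lemma path_comp_interchange p h h' m : q < p -> composable h -> composable h' ->
  (forall k, tgt p (h k) = src p (h' k)) ->
  path_comp (fun k => ocomp p (h k) (h' k)) m =
  ocomp p (path_comp h m) (path_comp h' m).
Proof.
move=> qp hP h'P hh'; elim: m => [|m IH] /=.
  have -> : src q (h' 0) = src q (h 0).
    by rewrite -(src_src_lt _ qp) -hh' src_tgt_lt.
  by rewrite src_comp_gt // -{2}(src_src_le (h 0) (ltnW qp)) comp_srcl.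
rewrite IH comp_interchange // ?path_comp_tgt //.
by rewrite tgt_path_comp // src_path_comp //; apply: eq_path_comp.
Qed.

Definition ident (y : Y) := y = src q y.

Lemma comp_ident_r (y z : Y) : ident z -> tgt q y = src q z -> ocomp q y z = y.
Proof. by move=> zid yz; rewrite zid -yz comp_tgtr. Qed.

Lemma path_comp_ident h m : composable h ->
  (forall k, k < m -> ident (h k)) -> path_comp h m = src q (h m).
Proof.
move=> hP; elim: m => // m IH hid /=.
rewrite IH; last by move=> k km; apply: hid; lia.
by rewrite comp_srcl -hP (hid m) // tgt_src_le.
Qed.

Lemma path_comp_single h k m : composable h ->
  (forall i, i != k -> ident (h i)) -> k < m -> path_comp h m = h k.
Proof.
move=> hP hid; elim: m => // m IH; rewrite ltnS leq_eqVlt => /orP[/eqP <-|km] /=.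
  rewrite path_comp_ident ?comp_srcl // => i ik.
  by apply: hid; rewrite neq_ltn ik.
rewrite comp_ident_r ?path_comp_tgt ?IH //.
by apply: hid; rewrite neq_ltn km orbT.
Qed.

(** The paths are padded at complementary ends, so the units cancel and both sides compose the same
    proper factors. This is the shape of a 0-composite in T. *)
Lemma path_comp_cat h h' i m : composable h -> composable h' ->
  src q (h i) = src q (h' i) -> i <= m ->
  (forall k, i <= k -> ident (h k)) -> (forall k, k < i -> ident (h' k)) ->
  path_comp (fun k => if k < i then h k else h' k) m =
  ocomp q (path_comp h m) (path_comp h' m).
Proof.
move=> hP h'P hh' im hid h'id.
have h'i : path_comp h' i = src q (h' i) by apply: path_comp_ident.
have h'0 : src q (h' 0) = src q (h' i).
  by rewrite -(path_comp_src i h'P) h'i src_src_le.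
have hm m' : i <= m' -> src q (h m') = src q (h i).
  elim: m' => [|m' IH]; first by rewrite leqn0 => /eqP ->.
  rewrite leq_eqVlt => /orP[/eqP -> //|im'].
  by rewrite -hP (hid m') // tgt_src_le // IH.
set g := fun k => _.
have gi m' : m' <= i -> path_comp g m' = path_comp h m'.
  elim: m' => [_|m' IH m'i] /=.
    (* For [i = 0] the spliced path already starts with [h' 0], whose source agrees with that of
       [h 0]. *)
    rewrite /g; case: ltnP => // i0; have -> : 0 = i by lia.
    by [].
  by rewrite IH ?(ltnW m'i) // /g m'i.
elim: m im => [|m IH].
  rewrite leqn0 => /eqP i0; rewrite gi ?i0 //= h'0 -hh' i0.
  by rewrite -{2}(src_src_le (h 0) (leqnn q)) comp_srcl.
rewrite leq_eqVlt ltnS => /orP[/eqP im|im].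
  by rewrite -im gi // h'i -hh' -(path_comp_tgt i hP) comp_tgtr.
rewrite /= IH // {1}/g ltnNge im /=.
have hmid := hid m im.
have -> : ocomp q (path_comp h m) (h m) = path_comp h m.
  by rewrite comp_ident_r // path_comp_tgt.
by rewrite Defs.compA // path_comp_tgt // path_comp_src // h'0 -hh' hm.
Qed.

End PathComp.

(** * Suspensions *)

Section Susp.
Variable C : ocat.

Lemma scell_valP (a : C) (k : 'I_1) : isSome (Some a) = (endpt false <= k < endpt true).
Proof. by rewrite ord1. Qed.

Definition scell (a : C) : susp C :=
  @BCell 1 (fun=> C) (endpt false) (endpt true) (fun=> Some a) isT (scell_valP a).

Definition sobj (e : bool) : susp C := bobj (fun=> C) (endpt e).

Variant susp_spec : susp C -> Prop :=
  | SuspObj e : susp_spec (sobj e)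
  | SuspCell a : susp_spec (scell a).

(** If the single component is present, the endpoints must be 0 and 1; if it is absent, they
    coincide. *)
Lemma suspP s : susp_spec s.
Proof.
case E : (bval s ord0) => [a|].
  have -> : s = scell a.
    have := bvalP s ord0; rewrite E /= => /esym h.
    have := ltn_ord (bcod s) => hc.
    by apply: bcell_eq => [||k]; rewrite ?(ord1 k) ?E //; apply: ord_inj => /=; lia.
  exact: SuspCell.
have := bvalP s ord0; rewrite E /= => h.
have := ltn_ord (bcod s); have := ltn_ord (bdom s); have := bdom_le s => *.
have -> : s = sobj (0 < bdom s).
  apply: bcell_eq => [||k]; rewrite ?(ord1 k) ?E //; apply: ord_inj;
    rewrite endptE; lia.
exact: SuspObj.
Qed.

Lemma src_sobj n e : src n (sobj e) = sobj e.
Proof. exact/esym/(fmap_src (endF C e) n tt). Qed.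

Lemma tgt_sobj n e : tgt n (sobj e) = sobj e.
Proof. exact/esym/(fmap_tgt (endF C e) n tt). Qed.

Lemma src0_scell a : src 0 (scell a) = sobj false. Proof. by []. Qed.
Lemma tgt0_scell a : tgt 0 (scell a) = sobj true. Proof. by []. Qed.

Lemma srcS_scell n a : src n.+1 (scell a) = scell (src n a).
Proof. exact: bcell_eq. Qed.

Lemma tgtS_scell n a : tgt n.+1 (scell a) = scell (tgt n a).
Proof. exact: bcell_eq. Qed.

Lemma compS_scell n a b : ocomp n.+1 (scell a) (scell b) = scell (ocomp n a b).
Proof. exact: bcell_eq. Qed.

Lemma scell_inj : injective scell.
Proof. by move=> a b /(congr1 (fun s => bval s ord0)) []. Qed.

End Susp.

Lemma suspF_obj (C D : ocat) (g : functor C D) e : suspF g (sobj C e) = sobj D e.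
Proof. by apply: bcell_eq => // k; rewrite bmap_idE. Qed.

Lemma suspF_cell (C D : ocat) (g : functor C D) a : suspF g (scell a) = scell (g a).
Proof. by apply: bcell_eq => // k; rewrite bmap_idE. Qed.

Lemma edgeF_dom n (A : 'I_n -> ocat) (k : 'I_n) (s : susp (A k)) :
  bdom (edgeF A k s) = k + bdom s :> nat.
Proof. by rewrite /= inordK //; have := ltn_ord (bdom s); have := ltn_ord k; lia. Qed.

Lemma edgeF_cod n (A : 'I_n -> ocat) (k : 'I_n) (s : susp (A k)) :
  bcod (edgeF A k s) = k + bcod s :> nat.
Proof. by rewrite /= inordK //; have := ltn_ord (bcod s); have := ltn_ord k; lia. Qed.

Lemma edgeF_val n (A : 'I_n -> ocat) (k : 'I_n) (s : susp (A k)) :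
  bval (edgeF A k s) k = bval s ord0.
Proof.
have kk : inspan (dedge k) ord0 k.
  by rewrite /inspan /= !inordK /= /bump /=; have := ltn_ord k; lia.
by rewrite /= (bmap_valE _ _ kk) castF_id; case: bval.
Qed.

Lemma bcell_obj n (A : 'I_n -> ocat) (x : bracket A) :
  bdom x = bcod x -> x = bobj A (bdom x).
Proof.
move=> dc; apply: bcell_eq => //= k.
by have := bvalP x k; rewrite -dc leqNgt andNb; case: bval.
Qed.

Lemma edgeF_obj n (A : 'I_n -> ocat) (k : 'I_n) e :
  edgeF A k (sobj (A k) e) = bobj A (if e then ohi k else olo k).
Proof.
rewrite [LHS]bcell_obj //; congr bobj; apply: ord_inj.
by rewrite edgeF_dom endptE; case: e => /=; rewrite /bump /=; lia.
Qed.

Lemma bvalN n (A : 'I_n -> ocat) (x : bracket A) (k : 'I_n) :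
  ~~ (bdom x <= k < bcod x) -> bval x k = None.
Proof. by rewrite -bvalP; case: bval. Qed.

Lemma bcell_split_last n (A : 'I_n -> ocat) (x : bracket A) : bdom x < bcod x ->
  exists (x' : bracket A) (k : 'I_n) (a : A k),
    [/\ bcod x = k.+1 :> nat, tgt 0 x' = bobj A (olo k) &
        x = ocomp 0 x' (edgeF A k (scell a))].
Proof.
move=> xlt; have [k kE] : exists k : 'I_n, bcod x = k.+1 :> nat.
  have kP : (bcod x).-1 < n by have := ltn_ord (bcod x); lia.
  by exists (Ordinal kP); rewrite /= prednK //; lia.
case E : (bval x k) => [a|]; last by have := bvalP x k; rewrite E /=; lia.
have x'le : bdom x <= olo k by rewrite /=; lia.
have x'P (i : 'I_n) : isSome (if i < k then bval x i else None) = (bdom x <= i < olo k).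
  by case: ifP => /=; rewrite ?bvalP; lia.
pose x' : bracket A := BCell x'le x'P.
exists x', k, a; split => //.
have x'e : bcod x' = bdom (edgeF A k (scell a)).
  by apply: ord_inj; rewrite edgeF_dom /= addn0.
have [ed ec ev] := bcomp0E x'e.
apply: bcell_eq; first by rewrite [RHS]ed.
  by rewrite [RHS]ec; apply: ord_inj; rewrite edgeF_cod /=; lia.
move=> i; rewrite [RHS]ev [bval x' i]/=.
case: (ltngtP i k) => ik.
- rewrite [bval (edgeF _ _ _) i]bvalN; first by case: bval.
  by rewrite edgeF_dom edgeF_cod /=; lia.
- by rewrite (bvalN (x := x)) 1?(bvalN (x := edgeF _ _ _))
    ?edgeF_dom ?edgeF_cod //=; lia.
- by have {ik}-> : i = k by [apply: ord_inj]; rewrite edgeF_val E.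
Qed.

(** * The right column *)

Section RightColumn.
Variables (n : nat) (A : 'I_n -> ocat).

Lemma suspF_O_to_N e (k : 'I_n) s :
  suspF (edgeF A k) (O_to_N A e k s) =
  suspF (objF A (if e then ohi k else olo k)) s.
Proof.
case: (suspP s) => [e'|a]; first by rewrite /O_to_N !suspF_obj.
by rewrite /O_to_N !suspF_cell; congr scell; exact: edgeF_obj.
Qed.

Lemma right_leg_cocone : is_cocone (D := right_column A) (right_leg (A := A)).
Proof.
by case=> k; apply: functor_ext => s;
  [exact: suspF_O_to_N false k s | exact: suspF_O_to_N true k s].
Qed.

Lemma right_functor_eq (Y : ocat) (F G : functor (susp (bracket A)) Y) :
  (forall v : vert (right_column A),
    F \oF right_leg (A := A) v = G \oF right_leg (A := A) v) -> F = G.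
Proof.
move=> FG.
have FGobj j s : F (suspF (objF A j) s) = G (suspF (objF A j) s).
  exact: fmap_eq s (FG (RO j)).
have FGedge k s : F (suspF (edgeF A k) s) = G (suspF (edgeF A k) s).
  exact: fmap_eq s (FG (RN k)).
apply: functor_ext => s; case: (suspP s) => [e|x].
  by have := FGobj ord0 (sobj _ e); rewrite suspF_obj.
(* Induction on the target object: the 0-composite that splits off the last edge in T becomes a
   1-composite in [1];(T). *)
have [m] := ubnP (bcod x : nat); elim: m x => // m IH x; rewrite ltnS => xm.
have := bdom_le x; rewrite leq_eqVlt => /orP[/eqP/ord_inj dc|lt].
  have -> : x = objF A (bdom x) tt by exact: bcell_obj.
  by rewrite -suspF_cell FGobj.
have [x' [k [a [ck x'k xE]]]] := bcell_split_last lt.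
have x'kE : tgt 0 x' = src 0 (edgeF A k (scell a)).
  by rewrite x'k -fmap_src src0_scell edgeF_obj.
have x'm : bcod x' < m.
  have /(congr1 (fun y => bdom y : nat)) := x'k => /= ->; lia.
have kk : tgt 1 (scell x') = src 1 (scell (edgeF A k (scell a))).
  by rewrite tgtS_scell srcS_scell x'kE.
by rewrite xE -compS_scell !fmap_comp // IH // -suspF_cell FGedge.
Qed.

(** * The functor induced by a cocone on the right column *)

Variables (Y : ocat) (leg : forall v : vert (right_column A), functor (dobj v) Y).
Hypothesis legP : is_cocone leg.

Definition legO (j : 'I_n.+1) : functor (susp pt) Y := leg (RO j).
Definition legN (k : 'I_n) : functor (susp (susp (A k))) Y := leg (RN k).

Lemma legNO e k s : legN k (O_to_N A e k s) = legO (if e then ohi k else olo k) s.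
Proof.
by case: e; [exact: fmap_eq s (legP (ONhi k)) | exact: fmap_eq s (legP (ONlo k))].
Qed.

Definition pobj (e : bool) : Y := legO ord0 (sobj pt e).
(** Made total by [inord], so that indices are computed in nat; the value is the intended one for
    [i <= n]. *)
Definition opt (i : nat) : Y := legO (inord i) (scell (tt : pt)).
Definition ncell k (a : A k) : Y := legN k (scell (scell a)).

Lemma ordN_ind (P : 'I_n.+1 -> Prop) :
  P ord0 -> (forall k, P (olo k) -> P (ohi k)) -> forall j, P j.
Proof.
move=> P0 PS [m]; elim: m => [|m IH] mn.
  by have -> : Ordinal mn = ord0 by exact: ord_inj.
have mn' : m < n by [].
have -> : Ordinal mn = ohi (Ordinal mn') by apply: ord_inj.
by apply: PS; have -> : olo (Ordinal mn') = Ordinal (ltnW mn) by exact: ord_inj.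
Qed.

(** Consecutive copies of [1];([0]) have the same two objects in the [1];([1];(A_k)) between them,
    so agreement propagates along the zigzag. *)
Lemma legO_obj j e : legO j (sobj pt e) = pobj e.
Proof.
elim/ordN_ind: j => // k <-.
by rewrite -(legNO true) -(legNO false) /O_to_N !suspF_obj.
Qed.

Lemma legN_obj k e : legN k (sobj _ e) = pobj e.
Proof. by rewrite -(legO_obj (olo k)) -(legNO false) /O_to_N suspF_obj. Qed.

Lemma optE (j : 'I_n.+1) : legO j (scell (tt : pt)) = opt j.
Proof. by rewrite /opt inord_val. Qed.

Lemma legN_end k e : legN k (scell (sobj (A k) e)) = opt (k + e).
Proof.
have := legNO e k (scell (tt : pt)); rewrite /O_to_N suspF_cell.
rewrite [endF _ _ _](_ : _ = sobj (A k) e) // => ->; rewrite optE.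
by case: e; congr opt; rewrite /= /bump /=; lia.
Qed.

Lemma srcS_opt m i : src m.+1 (opt i) = opt i.
Proof. by rewrite /opt -fmap_src srcS_scell. Qed.

Lemma tgtS_opt m i : tgt m.+1 (opt i) = opt i.
Proof. by rewrite /opt -fmap_tgt tgtS_scell. Qed.

Lemma src0_opt i : src 0 (opt i) = pobj false.
Proof. by rewrite /opt -fmap_src src0_scell legO_obj. Qed.

Lemma tgt0_opt i : tgt 0 (opt i) = pobj true.
Proof. by rewrite /opt -fmap_tgt tgt0_scell legO_obj. Qed.

Lemma src_ncell k (a : A k) : src 1 (ncell a) = opt k.
Proof. by rewrite -fmap_src srcS_scell src0_scell legN_end addn0. Qed.

Lemma tgt_ncell k (a : A k) : tgt 1 (ncell a) = opt k.+1.
Proof. by rewrite -fmap_tgt tgtS_scell tgt0_scell legN_end addn1. Qed.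

Lemma srcSS_ncell m k (a : A k) : src m.+2 (ncell a) = ncell (src m a).
Proof. by rewrite -fmap_src !srcS_scell. Qed.

Lemma tgtSS_ncell m k (a : A k) : tgt m.+2 (ncell a) = ncell (tgt m a).
Proof. by rewrite -fmap_tgt !tgtS_scell. Qed.

Lemma comp_ncell m k (a b : A k) : tgt m a = src m b ->
  ocomp m.+2 (ncell a) (ncell b) = ncell (ocomp m a b).
Proof.
move=> ab; rewrite -fmap_comp ?tgtS_scell ?srcS_scell ?ab //.
by rewrite !compS_scell.
Qed.

(** The [i]-th 1-composition factor of the image of [x], padded with
    identities outside of the range of [x]. *)
Definition factor (x : bracket A) (i : nat) : Y :=
  let pad := opt (if i < bdom x then bdom x else bcod x) in
  oapp (fun k => oapp (@ncell k) pad (bval x k)) pad (insub i).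

Lemma factor_in x (k : 'I_n) a : bval x k = Some a -> factor x k = ncell a.
Proof. by move=> E; rewrite /factor valK /= E. Qed.

Lemma factor_out x i : ~~ (bdom x <= i < bcod x) ->
  factor x i = opt (if i < bdom x then bdom x else bcod x).
Proof.
by move=> xi; rewrite /factor; case: insubP => //= k _ ki; rewrite bvalN ?ki.
Qed.

Variant factor_spec (x : bracket A) (i : nat) : Y -> Prop :=
  | FactorIn (k : 'I_n) a of i = k & bval x k = Some a & bdom x <= k < bcod x :
      factor_spec x i (ncell a)
  | FactorOut of ~~ (bdom x <= i < bcod x) :
      factor_spec x i (opt (if i < bdom x then bdom x else bcod x)).

Lemma factorP x i : factor_spec x i (factor x i).
Proof.
case xi : (bdom x <= i < bcod x); last first.
  by rewrite factor_out ?xi //; constructor; rewrite xi.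
have iP : i < n by have := ltn_ord (bcod x); lia.
have := bvalP x (Ordinal iP); rewrite xi.
case E : (bval _ _) => [a|] // _.
by rewrite (factor_in E); constructor.
Qed.

(** The object at which the padded path stands before step [i]: it waits at the source of [x],
    climbs, then waits at the target. *)
Definition clamp (x : bracket A) (i : nat) := maxn (bdom x) (minn i (bcod x)).

Lemma src_factor x i : src 1 (factor x i) = opt (clamp x i).
Proof.
have := bdom_le x; rewrite /clamp; case: factorP => [k a -> _ h|h] xle.
  by rewrite src_ncell; congr opt; lia.
by rewrite srcS_opt; congr opt; case: ifP; lia.
Qed.

Lemma tgt_factor x i : tgt 1 (factor x i) = opt (clamp x i.+1).
Proof.
have := bdom_le x; rewrite /clamp; case: factorP => [k a -> _ h|h] xle.
  by rewrite tgt_ncell; congr opt; lia.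
by rewrite tgtS_opt; congr opt; case: ifP; lia.
Qed.

Lemma factor_composable x : composable 1 (factor x).
Proof. by move=> i; rewrite src_factor tgt_factor. Qed.

Lemma factor_ident x i : ~~ (bdom x <= i < bcod x) -> ident 1 (factor x i).
Proof. by move=> xi; rewrite /ident factor_out // srcS_opt. Qed.

(** The full length [n] is used for every [x], so that cells with different endpoints are compared
    along paths of equal length. *)
Definition hcomp (x : bracket A) : Y := path_comp 1 (factor x) n.

Lemma src1_hcomp x : src 1 (hcomp x) = opt (bdom x).
Proof.
rewrite path_comp_src; last exact: factor_composable.
by rewrite src_factor /clamp min0n maxn0.
Qed.

Lemma tgt1_hcomp x : tgt 1 (hcomp x) = opt (bcod x).
Proof.
rewrite path_comp_tgt; last exact: factor_composable.
rewrite src_factor /clamp; congr opt.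
by have := bdom_le x; have := ltn_ord (bcod x); lia.
Qed.

Lemma hcomp_obj (i : 'I_n.+1) : hcomp (bobj A i) = opt i.
Proof.
rewrite /hcomp path_comp_ident; first 1 last.
- exact: factor_composable.
- by move=> k _; apply: factor_ident => /=; lia.
by rewrite src_factor /clamp /=; congr opt; lia.
Qed.

(** Each bracket raises dimension by one: [m] in A_k corresponds to [m.+1] in T and to [m.+2] in
    [1];(T). *)
Lemma srcS_hcomp m x : src m.+2 (hcomp x) = hcomp (src m.+1 x).
Proof.
rewrite src_path_comp //; last exact: factor_composable.
apply: eq_path_comp => i; case: factorP => [k a -> ka _|h].
  by rewrite (@factor_in _ k (src m a)) /= ?ka // srcSS_ncell.
by rewrite factor_out // srcS_opt.
Qed.

Lemma tgtS_hcomp m x : tgt m.+2 (hcomp x) = hcomp (tgt m.+1 x).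
Proof.
rewrite tgt_path_comp //; last exact: factor_composable.
apply: eq_path_comp => i; case: factorP => [k a -> ka _|h].
  by rewrite (@factor_in _ k (tgt m a)) /= ?ka // tgtSS_ncell.
by rewrite factor_out // tgtS_opt.
Qed.

(** Above dimension 0 composition in T is componentwise, so interchange carries it across the path;
    the paddings of [x] and [y] coincide and are units. *)
Lemma compS_hcomp m (x y : bracket A) : tgt m.+1 x = src m.+1 y ->
  hcomp (ocomp m.+1 x y) = ocomp m.+2 (hcomp x) (hcomp y).
Proof.
move=> xy.
have xd : bdom x = bdom y by have := congr1 (@bdom _ _) xy.
have xc : bcod x = bcod y by have := congr1 (@bcod _ _) xy.
have xyv k : omap (tgt m) (bval x k) = omap (src m) (bval y k).
  by have := congr1 (fun z => bval z k) xy.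
have fxy i : tgt m.+2 (factor x i) = src m.+2 (factor y i).
  case: (factorP x i) => [k a -> ka _|h].
    have := xyv k; rewrite ka; case kb : (bval y k) => [b|] //= [ab].
    by rewrite (factor_in kb) tgtSS_ncell srcSS_ncell ab.
  by rewrite factor_out -?xd -?xc // tgtS_opt srcS_opt.
rewrite /hcomp -path_comp_interchange //; try exact: factor_composable.
apply: eq_path_comp => i; case: (factorP x i) => [k a -> ka _|h].
  have := xyv k; rewrite ka; case kb : (bval y k) => [b|] //= [ab].
  rewrite (factor_in kb) comp_ncell //; apply: factor_in.
  by rewrite /= /bcomp_val ka kb.
rewrite !factor_out -?xd -?xc //.
by rewrite -{2}(srcS_opt m.+1) comp_srcl.
Qed.

(** At the common object [bcod x] the path of [x] has reached its final padding and that of [y] has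
    not left its initial one, so the two concatenate. *)
Lemma comp0_hcomp (x y : bracket A) : tgt 0 x = src 0 y ->
  hcomp (ocomp 0 x y) = ocomp 1 (hcomp x) (hcomp y).
Proof.
move=> xy; have xy' : bcod x = bdom y by have := congr1 (@bdom _ _) xy.
have [ed ec ev] := bcomp0E xy'.
have xle := bdom_le x; have yle := bdom_le y.
rewrite /hcomp -[ocomp 0 x y]/(bcomp 0 x y) -(@path_comp_cat _ _ _ _ (bcod x));
  try exact: factor_composable.
- apply: eq_path_comp => i; case: ltnP => ix.
    case: (factorP x i) => [k a -> ka _|h].
      by apply: factor_in; rewrite ev ka.
    have ix' : i < bdom x by lia.
    by rewrite factor_out ed ?ix' //; lia.
  case: (factorP y i) => [k a ik ka h|h].
    rewrite ik; apply: factor_in; rewrite ev bvalN //; lia.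
  have iy : (i < bdom y) = false by rewrite -xy'; lia.
  have ix' : (i < bdom x) = false by lia.
  by rewrite factor_out ed ec ?ix' ?iy //;
    move: h; rewrite -xy'; lia.
- by rewrite !src_factor /clamp -xy'; congr opt; rewrite -xy' in yle; lia.
- by have := ltn_ord (bcod x); lia.
- by move=> k xk; apply: factor_ident; lia.
- by move=> k xk; apply: factor_ident; rewrite -xy'; lia.
Qed.

Lemma hcomp_edge k (a : A k) : hcomp (edgeF A k (scell a)) = ncell a.
Proof.
have E : factor (edgeF A k (scell a)) k = ncell a by apply: factor_in; rewrite edgeF_val.
rewrite /hcomp (@path_comp_single _ _ _ k) //; first exact: factor_composable.
by move=> i ik; apply: factor_ident; rewrite edgeF_dom edgeF_cod /=; lia.
Qed.

Definition right_fun (s : susp (bracket A)) : Y :=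
  if bval s ord0 is Some x then hcomp x else pobj (bdom s == ord_max).

Lemma right_fun_obj e : right_fun (sobj _ e) = pobj e.
Proof. by rewrite /right_fun /=; case: e. Qed.

Lemma right_fun_cell x : right_fun (scell x) = hcomp x.
Proof. by []. Qed.

Lemma src_pobj m e : src m (pobj e) = pobj e.
Proof. by rewrite -fmap_src src_sobj. Qed.

Lemma tgt_pobj m e : tgt m (pobj e) = pobj e.
Proof. by rewrite -fmap_tgt tgt_sobj. Qed.

Lemma right_fun_src m s : right_fun (src m s) = src m (right_fun s).
Proof.
case: (suspP s) => [e|x]; first by rewrite src_sobj right_fun_obj src_pobj.
case: m => [|[|m]].
- rewrite src0_scell right_fun_obj right_fun_cell.
  by rewrite -(src_src_lt (n := 1)) // src1_hcomp src0_opt.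
- by rewrite srcS_scell !right_fun_cell src1_hcomp -hcomp_obj.
- by rewrite srcS_scell !right_fun_cell srcS_hcomp.
Qed.

Lemma right_fun_tgt m s : right_fun (tgt m s) = tgt m (right_fun s).
Proof.
case: (suspP s) => [e|x]; first by rewrite tgt_sobj right_fun_obj tgt_pobj.
case: m => [|[|m]].
- rewrite tgt0_scell right_fun_obj right_fun_cell.
  by rewrite -(tgt_tgt_lt (n := 1)) // tgt1_hcomp tgt0_opt.
- by rewrite tgtS_scell !right_fun_cell tgt1_hcomp -hcomp_obj.
- by rewrite tgtS_scell !right_fun_cell tgtS_hcomp.
Qed.

Lemma right_fun_laws : functor_laws right_fun.
Proof.
split; [exact: right_fun_src | exact: right_fun_tgt | move=> m s t].
case: (suspP s) => [e|x].
  by rewrite tgt_sobj => ->; rewrite right_fun_src !comp_srcl.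
case: (suspP t) => [e|y].
  by rewrite src_sobj => <-; rewrite right_fun_tgt !comp_tgtr.
(* Two cells of Hom(0,1) never compose along dimension 0. *)
case: m => [|m].
  by rewrite tgt0_scell src0_scell => /(congr1 (fun s => bdom s : nat)).
rewrite tgtS_scell srcS_scell compS_scell !right_fun_cell => /scell_inj xy.
by case: m xy => [|m] xy; [exact: comp0_hcomp | exact: compS_hcomp].
Qed.

Definition right_functor : functor (susp (bracket A)) Y := Functor right_fun_laws.

Lemma right_functor_leg v : right_functor \oF right_leg (A := A) v = leg v.
Proof.
apply: functor_ext; case: v => [j|k] s.
  change (right_fun (suspF (objF A j) s) = legO j s).
  case: (suspP s) => [e|[]]; first by rewrite suspF_obj right_fun_obj legO_obj.
  by rewrite suspF_cell right_fun_cell optE -hcomp_obj.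
change (right_fun (suspF (edgeF A k) s) = legN k s).
case: (suspP s) => [e|t]; first by rewrite suspF_obj right_fun_obj legN_obj.
rewrite suspF_cell right_fun_cell.
case: (suspP t) => [e|a]; last exact: hcomp_edge.
rewrite edgeF_obj hcomp_obj legN_end; congr opt.
by case: e => /=; rewrite /bump /=; lia.
Qed.

End RightColumn.

Lemma right_colimit n (A : 'I_n -> ocat) : is_colimit (D := right_column A)
  (X := susp (bracket A)) (right_leg (A := A)).
Proof.
split=> [|Y leg legP]; first exact: right_leg_cocone.
exists (right_functor legP); split=> [v|F FP]; first exact: right_functor_leg.
by apply: right_functor_eq => v; rewrite FP; apply: right_functor_leg.
Qed.

(** * The induced maps *)

Section Induced.
Variables (n : nat) (A : 'I_n -> ocat) (G : forall k, cylinder (A k)).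

(** The legs at the E_k are forced by those at the Q_k; the two hypotheses say that the route
    through the P_j gives the same. *)
Lemma mid_induced (Y : ocat) (p : forall j, functor (Pcat A j) Y)
    (q : forall k, functor (Qcat G k) Y) :
  (forall k, p (olo k) \oF T_to_Plo A k = q k \oF E_to_Q G false k) ->
  (forall k, p (ohi k) \oF T_to_Phi A k = q k \oF E_to_Q G true k) ->
  exists! F : functor (mid_cylinder G) Y,
    (forall j, F \oF colim_in (D := mid_column G) (MP j) = p j) /\
    (forall k, F \oF colim_in (D := mid_column G) (MQ k) = q k).
Proof.
move=> pq_lo pq_hi.
pose leg (v : vert (mid_column G)) : functor (dobj v) Y :=
  match v return functor (mid_obj G v) Y with
  | MP j => p j
  | MQ k => q k
  | MEplus k => q k \oF E_to_Q G false k
  | MEminus k => q k \oF E_to_Q G true k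
  end.
have legP : is_cocone leg by case.
have [inP /(_ _ _ legP)[F [FP Funiq]]] := colim_is_colimit (mid_column G).
exists F; split; first by split=> [j|k]; rewrite FP.
move=> F' [F'p F'q]; apply: Funiq.
case=> [j|k|k|k]; [exact: F'p | exact: F'q | |].
  by rewrite -[colim_in _](inP (EplusQ k)) /leg -F'q; exact: functor_ext.
by rewrite -[colim_in _](inP (EminusQ k)) /leg -F'q; exact: functor_ext.
Qed.

Variable kappa : forall k, functor (G k) (oprod arrow (A k)).
Hypothesis kappa_end : forall k e, kappa k \oF cyl_end (G k) e = prod_end (A k) e.

(** Either end of [1] x A_k projects to the identity of A_k, and the other components are
    untouched. *)
Lemma Q_to_M_E e k : Q_to_M kappa k \oF E_to_Q G e k = idF (Tcat A).
Proof.
apply: functor_ext => x; apply: bcell_eq => // i.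
rewrite compFE bmap_idE [bval (E_to_Q _ _ _ _) i]bmap_idE.
case: (bval x i) => //= a; congr Some; rewrite /repl.
case: (i == k) => //=.
by rewrite -compFE kappa_end.
Qed.

Lemma kappa_induced : exists! F, induced_left kappa F.
Proof.
apply: mid_induced => k; apply: functor_ext => x; rewrite !compFE;
  rewrite -[Q_to_M _ _ _]compFE Q_to_M_E //.
(* The leg at M_k is defined through P_(k-1), so only the side of P_k calls for the cocone
   equation. *)
have [/(_ (MPhi k)) cP _] := left_colimit A.
exact: fmap_eq x cP.
Qed.

(** This face omits the object 0, so its image lies beyond the inserted edge; dually, the last face
    stays before it. *)
Lemma P_split_face_lo0 x : P_split A ord0 (face_lo A ord0 x) = sobj pt true.
Proof.
by apply: arrow_eq; rewrite splitF_dom || rewrite splitF_cod; congr endpt;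
  rewrite /= /bump /=; lia.
Qed.

Lemma P_split_face_hi_max x :
  P_split A ord_max (face_hi A ord_max x) = sobj pt false.
Proof.
have := ltn_ord (bdom x); have := ltn_ord (bcod x) => dc dd.
by apply: arrow_eq; rewrite splitF_dom || rewrite splitF_cod; congr endpt;
  rewrite /= /bump /=; lia.
Qed.

Lemma kappa_mid_end (F : functor (mid_cylinder G) _) e :
  induced_left kappa F -> F \oF cyl_end (mid_cylinder G) e = prod_end (Tcat A) e.
Proof.
case=> FP _; apply: functor_ext => x.
by case: e; rewrite [LHS](fmap_eq _ (FP _)); congr pair;
  [exact: P_split_face_lo0 | exact: collapse_faceF
  |exact: P_split_face_hi_max | exact: collapse_faceF].
Qed.

Variable sigma : forall k, functor (G k) (susp (A k)).
Hypothesis sigma_end :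
  forall k e, sigma k \oF cyl_end (G k) e = endF (A k) e \oF bang (A k).

Lemma Q_to_N_end e k (x : Tcat A) :
  bval (Q_to_N sigma k (E_to_Q G e k x)) ord0 =
  omap (fun=> sobj (A k) e) (bval x k).
Proof.
rewrite splitF_val [bval (E_to_Q _ _ _ _) k]bmap_idE.
case: (bval x k) => //= a; congr Some.
rewrite -[RHS]/((endF (A k) e \oF bang (A k)) a) -sigma_end /=; congr (sigma k _).
(* The cast and the component chosen by [E_to_Q] both depend on the boolean [k == k]; generalising
   it removes them together. *)
rewrite /repl; move: (repl_at G k); rewrite /repl.
case: (k == k) (eqxx k) => // _ r.
by rewrite castF_id.
Qed.

(** On both sides the endpoints record which ends of [x] lie beyond the edge [k], and a component,
    if present, is the object [e] of [1];(A_k). Leaving [f] abstract treats the two ends at once. *)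
Lemma right_compat e k (j := if e then ohi k else olo k)
    (f : functor (Tcat A) (Pcat A j)) :
  (forall x, (j < bdom (f x)) = (k < bdom x)) ->
  (forall x, (j < bcod (f x)) = (k < bcod x)) ->
  O_to_N A e k \oF P_split A j \oF f = Q_to_N sigma k \oF E_to_Q G e k.
Proof.
move=> fd fc; apply: functor_ext => x; rewrite !compFE.
apply: bcell_eq.
- rewrite [RHS]splitF_dom -[LHS]/(bdom (P_split A j (f x))) splitF_dom.
  by rewrite fd.
- rewrite [RHS]splitF_cod -[LHS]/(bcod (P_split A j (f x))) splitF_cod.
  by rewrite fc.
move=> l; rewrite (ord1 l) Q_to_N_end bmap_idE.
have := bvalP (P_split A j (f x)) ord0; rewrite splitF_dom splitF_cod fd fc !endptE.
have := bvalP x k.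
case: (bval x k) => [a|]; case: (bval (P_split A j (f x)) ord0) => [b|] //=; lia.
Qed.

Lemma right_compat_lo k :
  O_to_N A false k \oF P_split A (olo k) \oF T_to_Plo A k =
  Q_to_N sigma k \oF E_to_Q G false k.
Proof. by apply: (@right_compat false) => x; rewrite /= /bump /=; lia. Qed.

Lemma right_compat_hi k :
  O_to_N A true k \oF P_split A (ohi k) \oF T_to_Phi A k =
  Q_to_N sigma k \oF E_to_Q G true k.
Proof. by apply: (@right_compat true) => x; rewrite /= /bump /=; lia. Qed.

Lemma sigma_induced : exists! F, induced_right sigma F.
Proof.
have [rP _] := right_colimit A.
apply: mid_induced => k; apply: functor_ext => x; rewrite !compFE.
  rewrite -[Q_to_N _ _ _]compFE -right_compat_lo.
  by rewrite -[LHS](fmap_eq _ (rP (ONlo k))).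
rewrite -[Q_to_N _ _ _]compFE -right_compat_hi.
by rewrite -[LHS](fmap_eq _ (rP (ONhi k))).
Qed.

Lemma sigma_mid_end (F : functor (mid_cylinder G) _) e :
  induced_right sigma F ->
  F \oF cyl_end (mid_cylinder G) e = endF (Tcat A) e \oF bang (Tcat A).
Proof.
case=> FP _; apply: functor_ext => x.
case: e; rewrite [LHS](fmap_eq _ (FP _)) [LHS]compFE.
  by rewrite [P_split _ _ _]P_split_face_lo0; exact: suspF_obj.
by rewrite [P_split _ _ _]P_split_face_hi_max; exact: suspF_obj.
Qed.

End Induced.

(** * Recursion over the cells of Theta *)

(** Existence excludes the default [F0], and uniqueness passes to the chosen functor. *)
Lemma the_functorP (C D : ocat) (F0 : functor C D) (X : functor C D -> Prop) :
  (exists! F, X F) -> unique X (the_functor F0 X).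
Proof.
case=> F [XF Funiq].
have XtF : X (the_functor F0 X).
  rewrite /the_functor; case: pselect => [e|]; first exact: projT2 (cid e).
  by case; exists F.
by split=> // F' XF'; rewrite -(Funiq _ XtF) (Funiq _ XF').
Qed.

(** The ends for the A_k give the compatibilities, hence the defining properties of [kappa] and
    [sigma] at T; the ends at T are then read off on P_0 and P_n. *)
Lemma kappa_sigma_end (S : theta) (e : bool) :
  kappa S \oF cyl_end (gray S) e = prod_end (realize S) e /\
  sigma S \oF cyl_end (gray S) e = endF (realize S) e \oF bang (realize S).
Proof.
elim: S e => n A IH e.
have kP k e' := (IH k e').1; have sP k e' := (IH k e').2.
split.
  exact: kappa_mid_end (the_functorP _ (kappa_induced kP)).1.
exact: sigma_mid_end (the_functorP _ (sigma_induced sP)).1.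
Qed.

Theorem proposition3p3 (n : nat) (A : 'I_n -> theta) :
  let S := Cell A in
  let B (k : 'I_n) := realize (A k) in
  let G (k : 'I_n) := gray (A k) in
  let kappaA (k : 'I_n) := kappa (A k) in
  let sigmaA (k : 'I_n) := sigma (A k) in
  (forall k : 'I_n,
    [/\ T_to_Plo B k \oF Q_to_M kappaA k \oF E_to_Q G false k = T_to_Plo B k,
        T_to_Phi B k \oF Q_to_M kappaA k \oF E_to_Q G true k = T_to_Phi B k,
        O_to_N B false k \oF P_split B (olo k) \oF T_to_Plo B k =
          Q_to_N sigmaA k \oF E_to_Q G false k
      & O_to_N B true k \oF P_split B (ohi k) \oF T_to_Phi B k =
          Q_to_N sigmaA k \oF E_to_Q G true k]) /\
  [/\ is_colimit (D := left_column B) (X := oprod arrow (realize S)) (left_leg (A := B)),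
      is_colimit (D := mid_column G) (X := gray S) (colim_in (D := mid_column G)),
      is_colimit (D := right_column B) (X := susp (realize S)) (right_leg (A := B)),
      unique (induced_left kappaA) (kappa S)
    & unique (induced_right sigmaA) (sigma S)] /\
  (forall e : bool,
    kappa S \oF cyl_end (gray S) e = prod_end (realize S) e /\
    sigma S \oF cyl_end (gray S) e = endF (realize S) e \oF bang (realize S)).
Proof.
move=> S B G kappaA sigmaA.
have kP k e := (kappa_sigma_end (A k) e).1.
have sP k e := (kappa_sigma_end (A k) e).2.
split; last split; last exact: kappa_sigma_end.
  move=> k; split; [| |exact: right_compat_lo|exact: right_compat_hi].
    by apply: functor_ext => x; rewrite !compFE -[Q_to_M _ _ _]compFE Q_to_M_E.
  by apply: functor_ext => x; rewrite !compFE -[Q_to_M _ _ _]compFE Q_to_M_E.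
split.
- exact: left_colimit.
- exact: colim_is_colimit.
- exact: right_colimit.
- exact: the_functorP (kappa_induced kP).
- exact: the_functorP (sigma_induced sP).
Qed.
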